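(* Let $K\in C^2(\mathbb{T}^d\times\mathbb{T}^d)$ be real-valued, and for $r\in\mathbb{N}_0^d$ let $K_{rr}$ and $\Sigma_{rr}$ be its rectangular partial Fourier sums and rectangular Fejér averages as defined in the context. If $K$ is positive semi-definite (respectively, symmetric), then $K_{rr}$ and $\Sigma_{rr}$ are also positive semi-definite (respectively, symmetric) for all $r\in\mathbb{N}_0^d$. Moreover, $$\lim_{\min_j r_j\to\infty}\|\Sigma_{rr}-K\|_{C^2(\mathbb{T}^d\times\mathbb{T}^d)}=0.$$ Additionally, if $K\in C^3(\mathbb{T}^d\times\mathbb{T}^d)$, then $$\lim_{\min_j r_j\to\infty}\|K_{rr}-K\|_{C^2(\mathbb{T}^d\times\mathbb{T}^d)}=0.$$
   Context: $\mathbb{T}^d$ is the $d$-dimensional flat torus (period $1$ in each coordinate). A kernel $K$ is positive semi-definite if $\int_{\mathbb{T}^d\times\mathbb{T}^d}K(x,y)f(x)f(y)\,dx\,dy\ge0$ for all (real-valued) $f\in L^\infty(\mathbb{T}^d)$, and symmetric if $K(x,y)=K(y,x)$ for all $x,y\in\mathbb{T}^d$. For $\alpha\in\mathbb{Z}^d$ write $|\alpha|=(|\alpha_1|,\dots,|\alpha_d|)$, and for $\alpha,r\in\mathbb{Z}^d$ write $\alpha\le r$ iff $\alpha_j\le r_j$ for all $1\le j\le d$. For $\alpha,\beta\in\mathbb{Z}^d$ set $$\hat K_{\alpha\beta}=\int_{\mathbb{T}^d\times\mathbb{T}^d}K(x,y)e^{-2i\pi(\alpha\cdot x+\beta\cdot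 y)}\,dx\,dy.$$ For $r_1,r_2\in\mathbb{N}_0^d$ the rectangular partial Fourier sum is $$K_{r_1r_2}(x,y)=\sum_{|\alpha|\le r_1,\ |\beta|\le r_2}\hat K_{\alpha\beta}\,e^{2i\pi(\alpha\cdot x+\beta\cdot y)},$$ and the rectangular Fejér average is $$\Sigma_{r_1r_2}(x,y)=\frac{1}{\prod_{j=1}^d(1+r_{1j})(1+r_{2j})}\sum_{s_1,s_2\in\mathbb{N}_0^d,\ s_1\le r_1,\ s_2\le r_2}K_{s_1s_2}(x,y).$$ $K_{rr}$ and $\Sigma_{rr}$ are obtained by taking $r_1=r_2=r$. For real-valued $K$ these are real-valued. *)

(* Defs.v *)
From HB Require Import structures.
From mathcomp Require Import all_boot all_order all_algebra.
From mathcomp Require Import all_classical all_reals all_analysis.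
From mathcomp Require Import complex zify.

Set Implicit Arguments.
Unset Strict Implicit.
Unset Printing Implicit Defensive.

Import Order.TTheory GRing.Theory Num.Theory.
Import numFieldNormedType.Exports.

Local Open Scope classical_set_scope.
Local Open Scope ring_scope.
Local Open Scope complex_scope.

(* Row vectors carry the product sigma-algebra, generated by the coordinates
   (the library provides it for tuples only). *)
Definition measure_rV_display : measure_display -> measure_display.
Proof. exact. Qed.

Section measurable_rV.
Context {d} {T : measurableType d}.
Variable n : nat.

Let coord : 'I_n -> 'rV[T]_n -> T := fun i x => x ord0 i.

Let rV_set0 : g_sigma_preimage coord set0.
Proof. exact: sigma_algebra0. Qed.

Let rV_setC A : g_sigma_preimage coord A -> g_sigma_preimage coord (~` A).
Proof. exact: sigma_algebraC. Qed.

Let rV_bigcup (F : (set 'rV[T]_n)^nat) :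
  (forall i, g_sigma_preimage coord (F i)) ->
  g_sigma_preimage coord (\bigcup_i (F i)).
Proof. exact: sigma_algebra_bigcup. Qed.

HB.instance Definition _ := @isMeasurable.Build (measure_rV_display d)
  'rV[T]_n (g_sigma_preimage coord) rV_set0 rV_setC rV_bigcup.

Lemma measurable_coord (i : 'I_n) :
  measurable_fun [set: 'rV[T]_n] (fun x : 'rV[T]_n => x ord0 i).
Proof.
move=> _ Y mY; rewrite setTI; apply: sub_sigma_algebra => /=.
rewrite -bigcup_seq/=; exists i => /=; first by rewrite mem_index_enum.
by exists Y => //; rewrite setTI.
Qed.

End measurable_rV.

Section measurable_fun_rV.
Context {d1 d2} {T1 : measurableType d1} {T2 : measurableType d2}.

Lemma measurable_fun_rV n (f : T1 -> 'rV[T2]_n) :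
  (forall i, measurable_fun [set: T1] (fun x => f x ord0 i)) ->
  measurable_fun [set: T1] f.
Proof.
move=> mf _ A mA; rewrite setTI.
pose S := [set B | measurable (f @^-1` B)].
suff /(_ _ mA) : measurable `<=` S by [].
apply: smallest_sub; first split.
- by rewrite /S/= preimage_set0.
- by move=> B SB; rewrite /S/= setTD preimage_setC; exact: measurableC.
- by move=> F SF; rewrite /S/= preimage_bigcup; exact: bigcupT_measurable.
move=> B; rewrite -bigcup_seq/= => -[i _ [C mC <-]].
by rewrite /S/= setTI -comp_preimage -[X in measurable X]setTI; exact: mf.
Qed.

End measurable_fun_rV.

Section torus_measure.
Variable R : realType.

(* Lebesgue measure on the fundamental domain of R / Z. *)
Definition circle_measure : set (measurableTypeR R) -> \bar R :=
  mrestr (@lebesgue_measure R) (@measurable_itv R `[0, 1]).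

HB.instance Definition _ := Measure.on circle_measure.

Let circle_measureT : circle_measure setT = 1%E.
Proof.
by rewrite /circle_measure /mrestr setTI lebesgue_measure_itv/= lte01 oppr0 adde0.
Qed.

HB.instance Definition _ :=
  Measure_isProbability.Build _ _ _ circle_measure circle_measureT.

Definition rV_cons n (p : measurableTypeR R * 'rV[R]_n) : 'rV[R]_n.+1 :=
  \row_i (if unlift ord0 i is Some j then p.2 ord0 j else p.1).

Lemma measurable_rV_cons n : measurable_fun [set: measurableTypeR R * 'rV[R]_n] (@rV_cons n).
Proof.
apply: measurable_fun_rV => i; under eq_fun do rewrite mxE.
case: (unlift ord0 i) => [j|]; last exact: measurable_fst.
exact: measurableT_comp (measurable_coord j) measurable_snd.
Qed.

HB.instance Definition _ n :=
  isMeasurableFun.Build _ _ _ _ (@rV_cons n) (@measurable_rV_cons n).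

(* n-fold product of circle_measure: integrating against it is integrating
   over the n-dimensional torus. *)
Fixpoint torus_measure n : probability 'rV[R]_n R :=
  if n is m.+1 then distribution (circle_measure \x torus_measure m)%E (@rV_cons m)
  else \d_(0 : 'rV[R]_0).

End torus_measure.

Section kernels.
Context {R : realType} {d : nat}.

(* Points of T^d are represented in R^d: functions on T^d * T^d are functions
   on R^d * R^d that are 1-periodic in each of the 2d coordinates, indexed by
   'I_d + 'I_d. *)
Local Notation point := ('rV[R]_d * 'rV[R]_d)%type.

Implicit Types (K : point -> R) (p : point).

Definition direction (c : 'I_d + 'I_d) : point :=
  match c with
  | inl i => (delta_mx 0 i, 0)
  | inr i => (0, delta_mx 0 i)
  end.

Definition torus_fun K := forall c, periodic K (direction c).

Definition pderiv (s : seq ('I_d + 'I_d)) K : point -> R :=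
  foldr (fun c F p => 'D_(direction c) F p) K s.

Definition Ck (k : nat) K :=
  forall s : seq ('I_d + 'I_d), (size s <= k)%N ->
    continuous (pderiv s K) /\
    ((size s < k)%N -> forall c p, derivable (pderiv s K) p (direction c)).

(* Maximum over all partial derivatives of order at most k of their supremum
   norms, valued in the extended reals so that it is meaningful for every K. *)
Definition Ck_norm (k : nat) K : \bar R :=
  ereal_sup [set (`|pderiv s K p|)%:E |
    s in [set s : seq ('I_d + 'I_d) | (size s <= k)%N] & p in [set: point]].

Definition torus2_measure : probability ('rV[R]_d * 'rV[R]_d)%type R :=
  (torus_measure R d \x torus_measure R d)%E.

Definition psd K := forall f : 'rV[R]_d -> R,
  f \in Lfun (torus_measure R d) +oo%E ->
  0 <= \int[torus2_measure]_p (K p * f p.1 * f p.2).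

Definition sym_kernel K := forall x y, K (x, y) = K (y, x).

Definition expi (t : R) : R[i] := cos t +i* sin t.

Definition dotz (a : {ffun 'I_d -> int}) (x : 'rV[R]_d) : R :=
  \sum_j (a j)%:~R * x ord0 j.

Definition phase (a b : {ffun 'I_d -> int}) p : R :=
  pi *+ 2 * (dotz a p.1 + dotz b p.2).

Definition Cintegral (F : point -> R[i]) : R[i] :=
  (\int[torus2_measure]_p complex.Re (F p)) +i* (\int[torus2_measure]_p complex.Im (F p)).

Definition fourier_coef K (a b : {ffun 'I_d -> int}) : R[i] :=
  Cintegral (fun p => (K p)%:C * expi (- phase a b p)).

Definition zbox (r : {ffun 'I_d -> nat}) : set {ffun 'I_d -> int} :=
  [set a : {ffun 'I_d -> int} | forall j, (`|a j| <= r j)%N].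

Definition nbox (r : {ffun 'I_d -> nat}) : set {ffun 'I_d -> nat} :=
  [set s : {ffun 'I_d -> nat} | forall j, (s j <= r j)%N].

Definition fourier_sumC K (r1 r2 : {ffun 'I_d -> nat}) p : R[i] :=
  \sum_(a \in zbox r1) \sum_(b \in zbox r2)
    fourier_coef K a b * expi (phase a b p).

Definition fejerC K (r1 r2 : {ffun 'I_d -> nat}) p : R[i] :=
  (\prod_j ((1 + r1 j) * (1 + r2 j))%N%:R)^-1 *
  \sum_(s1 \in nbox r1) \sum_(s2 \in nbox r2) fourier_sumC K s1 s2 p.

(* fourier_sumC and fejerC take real values (fourier_sumE, fejerE below). *)
Definition fourier_sum K r1 r2 p : R := complex.Re (fourier_sumC K r1 r2 p).

Definition fejer K r1 r2 p : R := complex.Re (fejerC K r1 r2 p).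

Lemma expiN (t : R) : expi (- t) = (expi t)^*.
Proof. by rewrite /expi cosN sinN. Qed.

Lemma phaseN a b p : phase (- a) (- b) p = - phase a b p.
Proof.
rewrite /phase /dotz -mulrN opprD -!sumrN; congr (_ * (_ + _));
  by apply: eq_bigr => j _; rewrite ffunE mulrNz mulNr.
Qed.

Lemma RintegralN_torus2 (f : point -> R) :
  \int[torus2_measure]_p (- f p) = - \int[torus2_measure]_p f p.
Proof.
rewrite /Rintegral (_ : (fun x => (- f x)%:E) = \- (EFin \o f))%E//.
rewrite [in LHS]integralE [in RHS]integralE funeposN funenegN.
set a := integral _ _ (_^\-)%E; set b := integral _ _ (_^\+)%E.
have : (0 <= a)%E by exact: integral_ge0.
have : (0 <= b)%E by exact: integral_ge0.
by case: a => [a||]; case: b => [b||]//= _ _; rewrite ?oppr0 ?opprB.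
Qed.

Lemma fourier_coefN K a b :
  fourier_coef K (- a) (- b) = (fourier_coef K a b)^*.
Proof.
rewrite /fourier_coef /Cintegral /=; congr (_ +i* _).
  by apply: eq_Rintegral => p _; rewrite phaseN opprK/= !mul0r cosN.
rewrite -RintegralN_torus2; apply: eq_Rintegral => p _.
by rewrite phaseN opprK/= !mul0r !addr0 sinN mulrN opprK.
Qed.

Lemma zboxN r a : zbox r (- a) <-> zbox r a.
Proof. by split=> h j; have := h j; rewrite ffunE abszN. Qed.

Lemma finite_zbox r : finite_set (zbox r).
Proof.
pose M := (\max_j r j)%N.
pose h (g : {ffun 'I_d -> 'I_(M + M).+1}) : {ffun 'I_d -> int} :=
  [ffun j => (g j)%:Z - M%:Z].
apply: (@sub_finite_set _ _ [set h g | g in setT]); last first.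
  exact/finite_image/finite_finset.
move=> a ra; exists [ffun j => inord (absz (a j + M%:Z))] => //.
apply/ffunP => j; rewrite !ffunE.
have := ra j; have : (r j <= M)%N by exact: leq_bigmax.
move: (a j) (r j) => z k kM zk; rewrite inordK; lia.
Qed.

Lemma finite_nbox r : finite_set (nbox r).
Proof.
pose M := (\max_j r j)%N.
pose h (g : {ffun 'I_d -> 'I_M.+1}) : {ffun 'I_d -> nat} := [ffun j => g j : nat].
apply: (@sub_finite_set _ _ [set h g | g in setT]); last first.
  exact/finite_image/finite_finset.
move=> s rs; exists [ffun j => inord (s j)] => //.
apply/ffunP => j; rewrite !ffunE inordK// ltnS.
exact: leq_trans (rs j) (leq_bigmax _).
Qed.

Lemma conjc_fsum (I : choiceType) (A : set I) (f : I -> R[i]) :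
  finite_set A -> (\sum_(a \in A) f a)^* = \sum_(a \in A) (f a)^*.
Proof. by move=> fA; rewrite !fsbig_finite// rmorph_sum. Qed.

Lemma fsum_zboxN r (f : {ffun 'I_d -> int} -> R[i]) :
  \sum_(a \in zbox r) f (- a) = \sum_(a \in zbox r) f a.
Proof.
rewrite [RHS](reindex_fsbig (@GRing.opp _) (zbox r))//; split.
- by move=> a /zboxN.
- by move=> a b _ _ /oppr_inj.
- by move=> a ra; exists (- a); rewrite ?opprK//; exact/zboxN.
Qed.

Lemma conjc_eqP (z : R[i]) : z^* = z -> (complex.Re z)%:C = z.
Proof. by case: z => x y [] /eqP; rewrite eqNr => /eqP ->. Qed.

Lemma fourier_sumC_conj K r1 r2 p :
  (fourier_sumC K r1 r2 p)^* = fourier_sumC K r1 r2 p.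
Proof.
rewrite /fourier_sumC conjc_fsum; last exact: finite_zbox.
rewrite -[RHS]fsum_zboxN; apply: eq_fsbigr => a _.
rewrite conjc_fsum; last exact: finite_zbox.
rewrite -[RHS]fsum_zboxN; apply: eq_fsbigr => b _.
by rewrite rmorphM/= fourier_coefN phaseN expiN.
Qed.

Lemma fourier_sumE K r1 r2 p :
  (fourier_sum K r1 r2 p)%:C = fourier_sumC K r1 r2 p.
Proof. exact/conjc_eqP/fourier_sumC_conj. Qed.

Lemma fejerE K r1 r2 p : (fejer K r1 r2 p)%:C = fejerC K r1 r2 p.
Proof.
apply: conjc_eqP; rewrite /fejerC rmorphM/= conjc_fsum; last exact: finite_nbox.
congr (_ * _).
  by rewrite fmorphV rmorph_prod/=; under eq_bigr do rewrite rmorph_nat.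
apply: eq_fsbigr => s _; rewrite conjc_fsum; last exact: finite_nbox.
by apply: eq_fsbigr => t _; exact: fourier_sumC_conj.
Qed.

End kernels.

(* The filter on N_0^d expressing that min_j r_j tends to infinity. *)
Definition min_infty (d : nat) : set_system {ffun 'I_d -> nat} :=
  filter_from setT
    (fun N : nat => [set r : {ffun 'I_d -> nat} | forall j, (N <= r j)%N]).
Arguments min_infty d : clear implicits.

Global Instance min_infty_filter d : ProperFilter (min_infty d).
Proof.
split.
  by move=> [N _ /(_ [ffun=> N])]; apply => j; rewrite ffunE.
apply: filter_from_filter; first by exists 0%N.
move=> M N _ _; exists (maxn M N) => // r rMN.
by split => j; apply: leq_trans (rMN j); rewrite ?leq_maxl ?leq_maxr.
Qed.

(* Main.v *)
Require Import Defs.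
From mathcomp Require Import all_boot all_order all_algebra.
From mathcomp Require Import all_classical all_reals all_analysis.
From mathcomp Require Import measurable_realfun ess_sup_inf complex zify ring lra.

Set Implicit Arguments.
Unset Strict Implicit.
Unset Printing Implicit Defensive.

Import Order.TTheory GRing.Theory Num.Theory.
Import numFieldNormedType.Exports.

Local Open Scope classical_set_scope.
Local Open Scope ring_scope.

(** Truncating the Fourier series of [K] at [r], or averaging these truncations,
    convolves [K] over the whole torus with a product of one-dimensional kernels,
    one for each of the [2d] coordinates: Dirichlet kernels D_N for
    [fourier_sum], Fejer kernels F_N for [fejer] ([fourier_sum_conv],
    [fejer_conv]).

    Positivity and symmetry. The same kernel k acts on both blocks of variables
    and is a finite sum k(x - u) = sum_l w_l phi_l(x) phi_l(u). Hence the
    quadratic form of the truncated kernel at f is the quadratic form of [K] at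
    the trigonometric polynomial g = sum_l w_l (int phi_l f) phi_l, whatever the
    signs of the weights w_l ([psd_separable]). Symmetry is the exchange of the
    two blocks.

    Convergence. Convolution commutes with partial derivatives
    ([pderiv_torus_conv_sub]), so the C^2 norm is controlled once each of the
    finitely many derivatives G of [K] of order at most 2 is uniformly
    approximated. Convolving in the coordinates one after the other reduces the
    error to one-dimensional errors e_c, amplified by the L^1 norms l_c of the
    kernels applied afterwards ([torus_conv_error]).
    - F_N is nonnegative with mean 1, and sin^2(pi t) F_N(t) <= 1/(N+1)
      pointwise, so it concentrates at the integers. Thus l_c = 1, and e_c tends
      to 0 by uniform continuity of G.
    - For D_N, the norm l_c grows only like log N ([mean_norm_dirichlet]), by a
      dyadic decomposition of the circle. If [K] is of class C^3 then G is of
      class C^1 and e_c is at most a multiple of l_c / sqrt N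
      ([dirichlet_axis_conv_rate]): the Lipschitz bound handles F_N, and D_N - F_N
      is, up to a constant, 1/(N+1) times the derivative of a kernel whose L^1
      norm is also logarithmic, so one integration by parts suffices.

    The components of [r] tend to infinity at unrelated speeds, and a logarithm
    of one could swamp a power of another. This is avoided by convolving in
    decreasing order of the l_c: the error e_c then only meets factors at most
    l_c, and l_c^(2d) e_c tends to 0. *)

(** * Means of bounded measurable functions *)

Section bounded_measurable.
Context d (T : measurableType d) (R : realType).
Implicit Types f g : T -> R.

(** The measures on the circle and on the torus are probabilities: on this class,
    which is closed under sums, products and composition, every mean is finite and Fubini's theorem
    applies without further hypotheses. *)
Definition bmfun f := measurable_fun setT f /\ exists M, forall x, `|f x| <= M.

Lemma bmfun_cst (c : R) : bmfun (fun=> c).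
Proof. by split; [exact: measurable_cst|exists `|c|]. Qed.

Lemma bmfunD f g : bmfun f -> bmfun g -> bmfun (fun x => f x + g x).
Proof.
move=> [mf [M fM]] [mg [N gN]]; split; first exact: measurable_funD.
by exists (M + N) => x; rewrite (le_trans (ler_normD _ _))// lerD.
Qed.

Lemma bmfunM f g : bmfun f -> bmfun g -> bmfun (fun x => f x * g x).
Proof.
move=> [mf [M fM]] [mg [N gN]]; split; first exact: measurable_funM.
by exists (M * N) => x; rewrite normrM ler_pM.
Qed.

Lemma bmfunN f : bmfun f -> bmfun (fun x => - f x).
Proof.
move=> [mf [M fM]]; split; first exact: measurableT_comp.
by exists M => x; rewrite normrN.
Qed.

Lemma bmfunB f g : bmfun f -> bmfun g -> bmfun (fun x => f x - g x).
Proof. by move=> bf bg; apply: bmfunD => //; exact: bmfunN. Qed.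

Lemma bmfun_norm f : bmfun f -> bmfun (fun x => `|f x|).
Proof.
move=> [mf [M fM]]; split; first exact: measurableT_comp.
by exists M => x; rewrite normr_id.
Qed.

Lemma bmfun_sum (I : Type) (s : seq I) (P : pred I) (F : I -> T -> R) :
  (forall i, bmfun (F i)) -> bmfun (fun x => \sum_(i <- s | P i) F i x).
Proof.
move=> bF; elim: s => [|i s IH].
  by under eq_fun do rewrite big_nil; exact: bmfun_cst.
under eq_fun do rewrite big_cons.
by case: (P i) => //; exact: bmfunD.
Qed.

Lemma bmfun_prod (I : Type) (s : seq I) (P : pred I) (F : I -> T -> R) :
  (forall i, bmfun (F i)) -> bmfun (fun x => \prod_(i <- s | P i) F i x).
Proof.
move=> bF; elim: s => [|i s IH].
  by under eq_fun do rewrite big_nil; exact: bmfun_cst.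
under eq_fun do rewrite big_cons.
by case: (P i) => //; exact: bmfunM.
Qed.

End bounded_measurable.

Lemma bmfun_comp d d' (T : measurableType d) (T' : measurableType d')
    (R : realType) (f : T -> R) (h : T' -> T) :
  bmfun f -> measurable_fun setT h -> bmfun (f \o h).
Proof.
by move=> [mf [M fM]] mh; split; [exact: measurableT_comp|exists M => x; exact: fM].
Qed.

Lemma Rintegral_sum d (T : measurableType d) (R : realType)
    (P : {measure set T -> \bar R}) (I : Type) (s : seq I) (F : I -> T -> R) :
  (forall i, P.-integrable setT (EFin \o F i)) ->
  P.-integrable setT (EFin \o (fun x => \sum_(i <- s) F i x)) /\
  \int[P]_x (\sum_(i <- s) F i x) = \sum_(i <- s) \int[P]_x F i x.
Proof.
move=> iF; elim: s => [|i s [IH1 IH2]].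
  rewrite big_nil (_ : (fun x : T => _) = cst 0); last first.
    by apply/funext => x; rewrite big_nil.
  by split; [exact: integrable0|rewrite /Rintegral integral0].
have E : (fun x => \sum_(j <- i :: s) F j x) = (fun x => F i x + \sum_(j <- s) F j x).
  by apply/funext => x; rewrite big_cons.
rewrite E big_cons -IH2; split; last by rewrite RintegralD.
exact: (integrableD measurableT (iF i) IH1).
Qed.

Section mean.
Context d (T : measurableType d) (R : realType).
Variable P : probability T R.
Implicit Types f g : T -> R.

Lemma bmfun_integrable f : bmfun f -> P.-integrable setT (EFin \o f).
Proof.
move=> [mf [M fM]]; apply: measurable_bounded_integrable => //.
  by rewrite (le_lt_trans (probability_le1 _ _))// ltry.
exists M; split; first exact: num_real.
by move=> y My x _ /=; rewrite (le_trans (fM x))// ltW.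
Qed.

Lemma meanD f g : bmfun f -> bmfun g ->
  \int[P]_x (f x + g x) = \int[P]_x f x + \int[P]_x g x.
Proof. by move=> bf bg; rewrite RintegralD//; exact: bmfun_integrable. Qed.

Lemma meanB f g : bmfun f -> bmfun g ->
  \int[P]_x (f x - g x) = \int[P]_x f x - \int[P]_x g x.
Proof. by move=> bf bg; rewrite RintegralB//; exact: bmfun_integrable. Qed.

Lemma meanZl c f : bmfun f -> \int[P]_x (c * f x) = c * \int[P]_x f x.
Proof. by move=> bf; rewrite RintegralZl//; exact: bmfun_integrable. Qed.

Lemma meanZr c f : bmfun f -> \int[P]_x (f x * c) = \int[P]_x f x * c.
Proof. by move=> bf; rewrite RintegralZr//; exact: bmfun_integrable. Qed.

Lemma mean_cst (c : R) : \int[P]_x c = c.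
Proof.
rewrite Rintegral_cst// -[RHS]mulr1; congr (_ * _).
apply: (congr1 fine (y := 1%E)).
exact: probability_setT.
Qed.

Lemma mean_sum (I : Type) (s : seq I) (F : I -> T -> R) :
  (forall i, bmfun (F i)) ->
  \int[P]_x (\sum_(i <- s) F i x) = \sum_(i <- s) \int[P]_x F i x.
Proof. by move=> bF; apply: (Rintegral_sum s (fun i => bmfun_integrable (bF i))).2. Qed.

Lemma le_mean f g : bmfun f -> bmfun g -> (forall x, f x <= g x) ->
  \int[P]_x f x <= \int[P]_x g x.
Proof. by move=> bf bg fg; apply: le_Rintegral => //; exact: bmfun_integrable. Qed.

Lemma le_norm_mean f : bmfun f -> `|\int[P]_x f x| <= \int[P]_x `|f x|.
Proof. by move=> bf; apply: le_normr_Rintegral => //; exact: bmfun_integrable. Qed.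

Lemma mean_le_cst f M : bmfun f -> (forall x, `|f x| <= M) ->
  `|\int[P]_x f x| <= M.
Proof.
move=> bf fM; rewrite (le_trans (le_norm_mean bf))// -[leRHS]mean_cst.
by apply: le_mean => //; [exact: bmfun_norm|exact: bmfun_cst].
Qed.

End mean.

Section mean_product.
Context d1 d2 (T1 : measurableType d1) (T2 : measurableType d2) (R : realType).
Variables (P1 : probability T1 R) (P2 : probability T2 R).

Lemma bmfun_section1 (f : T1 * T2 -> R) y : bmfun f -> bmfun (fun x => f (x, y)).
Proof.
move=> bf; apply: (bmfun_comp (h := fun x => (x, y)) bf).
exact: measurable_fun_pair.
Qed.

Lemma bmfun_section2 (f : T1 * T2 -> R) x : bmfun f -> bmfun (fun y => f (x, y)).
Proof.
move=> bf; apply: (bmfun_comp (h := fun y => (x, y)) bf).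
exact: measurable_fun_pair.
Qed.

Lemma bmfun_mean2 (f : T1 * T2 -> R) : bmfun f -> bmfun (fun x => \int[P2]_y f (x, y)).
Proof.
move=> bf; have [_ [M fM]] := bf; split; last first.
  by exists M => x; apply: mean_le_cst => //; exact: bmfun_section2.
have : measurable_fun setT (fubini_F P2 (EFin \o f)).
  apply: (@measurable_fubini_F _ _ _ _ _ P1).
  exact: (@bmfun_integrable _ _ _ (P1 \x P2)%E).
exact: measurableT_comp.
Qed.

Lemma mean_prod1 (f : T1 * T2 -> R) : bmfun f ->
  \int[(P1 \x P2)%E]_z f z = \int[P1]_x \int[P2]_y f (x, y).
Proof.
move=> bf; rewrite /Rintegral -integral12_prod_meas1; last first.
  exact: (@bmfun_integrable _ _ _ (P1 \x P2)%E).
congr fine; apply: eq_integral => x _; rewrite /fubini_F /= fineK//.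
apply: integrable_fin_num => //; apply: bmfun_integrable.
exact: bmfun_section2.
Qed.

Lemma mean_prod2 (f : T1 * T2 -> R) : bmfun f ->
  \int[(P1 \x P2)%E]_z f z = \int[P2]_y \int[P1]_x f (x, y).
Proof.
move=> bf; rewrite /Rintegral -integral21_prod_meas1; last first.
  exact: (@bmfun_integrable _ _ _ (P1 \x P2)%E).
congr fine; apply: eq_integral => x _; rewrite /fubini_G /= fineK//.
apply: integrable_fin_num => //; apply: bmfun_integrable.
exact: bmfun_section1.
Qed.

End mean_product.

Lemma mean_distribution d d' (T : measurableType d) (T' : measurableType d')
    (R : realType) (P : probability T R) (X : {RV P >-> T'}) (f : T' -> R) :
  bmfun f -> \int[distribution P X]_y f y = \int[P]_x f (X x).
Proof.
move=> bf; rewrite /Rintegral integral_distribution//.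
  by apply/measurable_EFinP; case: bf.
by apply: (@bmfun_integrable _ _ _ P (f \o X)); exact: bmfun_comp.
Qed.

(** * The circle and the coordinates of the torus *)

Section circle.
Variable R : realType.
Notation lam := (@circle_measure R).
Notation leb := (@lebesgue_measure R).

(** Reduction to a Lebesgue integral over a segment, where the fundamental
    theorem of calculus and changes of variables apply. *)
Lemma circle_mean (f : measurableTypeR R -> R) : measurable_fun setT f ->
  \int[lam]_s f s = \int[leb]_(s in `[0, 1]) f s.
Proof.
move=> mf; rewrite /Rintegral; congr fine.
transitivity (\int[lam]_(x in `[0%R, 1%R]) (f x)%:E)%E.
  rewrite [RHS](@integral_mkcond _ _ _ lam).
  apply: ae_eq_integral => //.
  - exact/measurable_EFinP.
  - apply/measurable_restrict => //=; rewrite ?setIT//.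
    apply: measurable_funS (measurableT) _ _ => //.
    exact/measurable_EFinP.
  - exists (~` `[0, 1]); split.
    + exact: measurableC.
    + rewrite /= /circle_measure /mrestr (_ : _ `&` _ = set0) ?measure0 //.
      exact: setICl.
    + move=> x /= h x01; apply: h => _.
      by rewrite patchE mem_set.
apply: (@eq_measure_integral _ _ _ _ leb) => A mA A01.
by rewrite /= /circle_measure /mrestr; congr (leb _); exact: setIidl.
Qed.

End circle.

Section resampling.
Variable R : realType.
Notation lam := (@circle_measure R).

Definition set_coord n (i : 'I_n) (x : 'rV[R]_n) (s : R) : 'rV[R]_n :=
  x + (s - x ord0 i) *: delta_mx 0 i.

Lemma set_coordE n (i : 'I_n) x s j :
  set_coord i x s ord0 j = if j == i then s else x ord0 j.
Proof.
rewrite !mxE eqxx /=; case: eqVneq => [->|_]; first by rewrite mulr1 subrKC.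
by rewrite mulr0 addr0.
Qed.

Lemma measurable_set_coord n (i : 'I_n) :
  measurable_fun setT (fun z : 'rV[R]_n * measurableTypeR R => set_coord i z.1 z.2).
Proof.
apply: measurable_fun_rV => j; under eq_fun do rewrite set_coordE.
case: (j == i); first exact: measurable_snd.
exact: measurableT_comp (measurable_coord j) measurable_fst.
Qed.

Lemma set_coord_cons0 n (a s : R) (x : 'rV[R]_n) :
  set_coord ord0 (rV_cons (a, x)) s = rV_cons (s, x).
Proof.
apply/rowP => j; rewrite set_coordE !mxE.
by case: unliftP => [k ->|->]; rewrite ?eqxx.
Qed.

Lemma set_coord_consS n (i : 'I_n) (a s : R) (x : 'rV[R]_n) :
  set_coord (lift ord0 i) (rV_cons (a, x)) s = rV_cons (a, set_coord i x s).
Proof.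
apply/rowP => j; rewrite set_coordE !mxE.
case: unliftP => [k ->|->]; last by [].
by rewrite (inj_eq lift_inj) set_coordE.
Qed.

Lemma bmfun_set_coord n (i : 'I_n) (f : 'rV[R]_n -> R) : bmfun f ->
  bmfun (fun z : 'rV[R]_n * measurableTypeR R => f (set_coord i z.1 z.2)).
Proof.
by move=> bf; apply: (bmfun_comp bf); exact: measurable_set_coord.
Qed.

(** Replacing one coordinate by an independent uniform variable preserves the
    product measure. Through this single property, statements about the circle
    are applied to one coordinate of the torus at a time. *)
Lemma torus_resample n (i : 'I_n) (f : 'rV[R]_n -> R) : bmfun f ->
  \int[torus_measure R n]_x f x =
  \int[torus_measure R n]_x \int[lam]_s f (set_coord i x s).
Proof.
elim: n i f => [[]//|n IH] i f bf /=.
have bfc : bmfun (fun z : measurableTypeR R * 'rV[R]_n => f (rV_cons z)).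
  by apply: (bmfun_comp bf); exact: measurable_rV_cons.
have bh : bmfun (fun x : 'rV[R]_n.+1 => \int[lam]_s f (set_coord i x s)).
  exact: (bmfun_mean2 (torus_measure R n.+1) lam (bmfun_set_coord i bf)).
rewrite !mean_distribution//.
have bhc : bmfun (fun z : measurableTypeR R * 'rV[R]_n =>
    \int[lam]_s f (set_coord i (rV_cons z) s)).
  by apply: (bmfun_comp bh); exact: measurable_rV_cons.
case: (unliftP ord0 i) bh bhc => [j ->|->] bh bhc.
  rewrite !mean_prod1//; apply: eq_Rintegral => a _.
  rewrite (IH j); last exact: (bmfun_section2 a bfc).
  apply: eq_Rintegral => x _; apply: eq_Rintegral => s _.
  by rewrite set_coord_consS.
rewrite !mean_prod2//; apply: eq_Rintegral => x _.
rewrite -[LHS](mean_cst lam); apply: eq_Rintegral => a _.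
by apply: eq_Rintegral => s _; rewrite set_coord_cons0.
Qed.

Section point.
Variable d : nat.
Notation point := ('rV[R]_d * 'rV[R]_d)%type.
Notation mu2 := (@torus2_measure R d).

Definition pcoord (c : 'I_d + 'I_d) (p : point) : R :=
  match c with inl i => p.1 ord0 i | inr i => p.2 ord0 i end.

Definition set_pcoord (c : 'I_d + 'I_d) (p : point) (s : R) : point :=
  p + (s - pcoord c p) *: direction c.

Lemma set_pcoord_inl i p s : set_pcoord (inl i) p s = (set_coord i p.1 s, p.2).
Proof. by case: p => x y; congr (_, _) => //=; rewrite scaler0 addr0. Qed.

Lemma set_pcoord_inr i p s : set_pcoord (inr i) p s = (p.1, set_coord i p.2 s).
Proof. by case: p => x y; congr (_, _) => //=; rewrite scaler0 addr0. Qed.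

Lemma point_eqP (p q : point) : (forall c, pcoord c p = pcoord c q) -> p = q.
Proof.
case: p q => [x y] [x' y'] h; congr (_, _); apply/rowP => i.
- exact: (h (inl i)).
- exact: (h (inr i)).
Qed.

Lemma pcoordD c p q : pcoord c (p + q) = pcoord c p + pcoord c q.
Proof. by case: c => i; rewrite /= mxE. Qed.

Lemma pcoordN c p : pcoord c (- p) = - pcoord c p.
Proof. by case: c => i; rewrite /= mxE. Qed.

Lemma pcoordB c p q : pcoord c (p - q) = pcoord c p - pcoord c q.
Proof. by rewrite pcoordD pcoordN. Qed.

Lemma pcoordZ c a p : pcoord c (a *: p) = a * pcoord c p.
Proof. by case: c => i; rewrite /= mxE. Qed.

Lemma pcoord_direction c c' :
  pcoord c (@direction R d c') = (c == c')%:R.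
Proof. by case: c => i; case: c' => j; rewrite /= !mxE ?eqxx. Qed.

Lemma point_sum_direction p : p = \sum_c pcoord c p *: direction c.
Proof.
apply: point_eqP => c.
rewrite (big_morph (pcoord c) (pcoordD c) (_ : pcoord c 0 = 0)); last first.
  by case: c => i; rewrite /= mxE.
rewrite (bigD1 c)//= big1 ?addr0 => [|c' c'c].
  by rewrite pcoordZ pcoord_direction eqxx mulr1.
by rewrite pcoordZ pcoord_direction eq_sym (negbTE c'c) mulr0.
Qed.

Definition mkpoint (f : 'I_d + 'I_d -> R) : point :=
  (\row_i f (inl i), \row_i f (inr i)).

Lemma pcoord_mkpoint f c : pcoord c (mkpoint f) = f c.
Proof. by case: c => i; rewrite /= mxE. Qed.

Lemma set_pcoordE c p s c' :
  pcoord c' (set_pcoord c p s) = if c' == c then s else pcoord c' p.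
Proof.
rewrite pcoordD pcoordZ pcoord_direction.
by case: eqVneq => [->|_]; rewrite ?mulr1 ?subrKC// mulr0 addr0.
Qed.

Lemma measurable_pcoord c : measurable_fun setT (pcoord c).
Proof.
case: c => i.
- exact: measurableT_comp (measurable_coord i) measurable_fst.
- exact: measurableT_comp (measurable_coord i) measurable_snd.
Qed.

Lemma measurable_fun_point d' (T : measurableType d') (f : T -> point) :
  (forall c, measurable_fun setT (fun x => pcoord c (f x))) -> measurable_fun setT f.
Proof.
move=> mf; rewrite (_ : f = fun x => ((f x).1, (f x).2)); last first.
  by apply/funext => x; rewrite -surjective_pairing.
apply: measurable_fun_pair; apply: measurable_fun_rV => i.
- exact: (mf (inl i)).
- exact: (mf (inr i)).
Qed.

Lemma measurable_set_pcoord c :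
  measurable_fun setT (fun z : point * measurableTypeR R => set_pcoord c z.1 z.2).
Proof.
apply: measurable_fun_point => c'; under eq_fun do rewrite set_pcoordE.
case: (c' == c); first exact: measurable_snd.
exact: measurableT_comp (measurable_pcoord c') measurable_fst.
Qed.

Lemma bmfun_set_pcoord c (f : point -> R) : bmfun f ->
  bmfun (fun z : point * measurableTypeR R => f (set_pcoord c z.1 z.2)).
Proof. by move=> bf; apply: (bmfun_comp bf); exact: measurable_set_pcoord. Qed.

Lemma torus2_resample c (f : point -> R) : bmfun f ->
  \int[mu2]_p f p = \int[mu2]_p \int[lam]_s f (set_pcoord c p s).
Proof.
move=> bf; have bh := bmfun_mean2 mu2 lam (bmfun_set_pcoord c bf).
case: c bh => i /= bh; rewrite /torus2_measure.
  rewrite !mean_prod2//; apply: eq_Rintegral => y _.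
  rewrite (torus_resample i); last exact: (bmfun_section1 y bf).
  apply: eq_Rintegral => x _; apply: eq_Rintegral => s _.
  by rewrite set_pcoord_inl.
rewrite !mean_prod1//; apply: eq_Rintegral => x _.
rewrite (torus_resample i); last exact: (bmfun_section2 x bf).
apply: eq_Rintegral => y _; apply: eq_Rintegral => s _.
by rewrite set_pcoord_inr.
Qed.

Lemma torus2_swap (f : point -> R) : bmfun f ->
  \int[mu2]_p f p = \int[mu2]_p f (p.2, p.1).
Proof.
move=> bf; have bs : bmfun (fun p : point => f (p.2, p.1)).
  by apply: (bmfun_comp bf); exact: measurable_swap.
by rewrite /torus2_measure mean_prod1// mean_prod2.
Qed.

End point.
End resampling.

(** * The Dirichlet and Fejer kernels *)

Section kernels.
Variable R : realType.
Implicit Types (t x : R) (N : nat).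

Definition dirichlet_kernel N t : R :=
  1 + 2 * \sum_(k < N) cos (k.+1%:R * (pi *+ 2 * t)).

Definition conj_dirichlet_kernel N t : R :=
  2 * \sum_(k < N) sin (k.+1%:R * (pi *+ 2 * t)).

Definition fejer_kernel N t : R := N.+1%:R^-1 * \sum_(s < N.+1) dirichlet_kernel s t.

Lemma dirichlet_kernelS N t : dirichlet_kernel N.+1 t =
  dirichlet_kernel N t + 2 * cos (N.+1%:R * (pi *+ 2 * t)).
Proof. by rewrite /dirichlet_kernel big_ord_recr/= mulrDr addrA. Qed.

Lemma conj_dirichlet_kernelS N t : conj_dirichlet_kernel N.+1 t =
  conj_dirichlet_kernel N t + 2 * sin (N.+1%:R * (pi *+ 2 * t)).
Proof. by rewrite /conj_dirichlet_kernel big_ord_recr/= mulrDr. Qed.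

(** Telescoping: sin x * 2 cos (2 k x) = sin ((2 k + 1) x) - sin ((2 k - 1) x). *)
Lemma sin_mul_dirichlet N t :
  sin (pi * t) * dirichlet_kernel N t = sin (N.*2.+1%:R * (pi * t)).
Proof.
elim: N => [|N IH].
  by rewrite /dirichlet_kernel big_ord0 mulr0 addr0 mulr1 mul1r.
rewrite dirichlet_kernelS mulrDr IH.
set a := pi * t; set b := N.+1%:R * _.
have -> : N.*2.+1%:R * a = b - a.
  by rewrite /a /b -mul2n -[in LHS]natr1 natrM -[in RHS]natr1; ring.
have -> : (N.+1).*2.+1%:R * a = b + a.
  by rewrite /a /b -mul2n -[in LHS]natr1 natrM; ring.
by rewrite sinB sinD; ring.
Qed.

Lemma sin_mul_conj_dirichlet N t :
  sin (pi * t) * conj_dirichlet_kernel N t =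
  cos (pi * t) - cos (N.*2.+1%:R * (pi * t)).
Proof.
elim: N => [|N IH].
  by rewrite /conj_dirichlet_kernel big_ord0 !mulr0 mul1r subrr.
rewrite conj_dirichlet_kernelS mulrDr IH.
set a := pi * t; set b := N.+1%:R * _.
have -> : N.*2.+1%:R * a = b - a.
  by rewrite /a /b -mul2n -[in LHS]natr1 natrM -[in RHS]natr1; ring.
have -> : (N.+1).*2.+1%:R * a = b + a.
  by rewrite /a /b -mul2n -[in LHS]natr1 natrM; ring.
by rewrite cosB cosD; ring.
Qed.

(** Telescoping again: sin x * sin ((2 s + 1) x) is the difference of the squares
    of sin ((s + 1) x) and sin (s x). *)
Lemma sin2_mul_sum_dirichlet N t :
  sin (pi * t) ^+ 2 * \sum_(s < N) dirichlet_kernel s t = sin (N%:R * (pi * t)) ^+ 2.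
Proof.
elim: N => [|N IH]; first by rewrite big_ord0 mul0r sin0 mulr0 expr0n.
rewrite big_ord_recr/= mulrDr IH expr2 -mulrA sin_mul_dirichlet.
set a := pi * t; set b := N%:R * a.
have -> : N.*2.+1%:R * a = b *+ 2 + a.
  by rewrite /b /a -mul2n -[in LHS]natr1 natrM; ring.
have -> : N.+1%:R * a = b + a by rewrite /b -natr1; ring.
rewrite (sinD (b *+ 2) a) (sinD b a) sin_mulr2n cos_mulr2n.
have := cos2Dsin2 a; have := cos2Dsin2 b.
move: (sin a) (cos a) (sin b) (cos b) => sa ca sb cb cb2 ca2.
apply/eqP; rewrite -subr_eq0; apply/eqP.
transitivity (sa ^+ 2 * (cb ^+ 2 + sb ^+ 2 - 1) - sb ^+ 2 * (ca ^+ 2 + sa ^+ 2 - 1)).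
  by ring.
by rewrite cb2 ca2 subrr !mulr0 subrr.
Qed.

(** The frequency k is damped in the Fejer kernel by the factor
    1 - k / (N + 1); the right-hand side is, up to a constant, the derivative of
    the conjugate kernel divided by N + 1. *)
Lemma dirichlet_fejer N t :
  dirichlet_kernel N t - fejer_kernel N t =
  N.+1%:R^-1 * (2 * \sum_(k < N) (k.+1%:R * cos (k.+1%:R * (pi *+ 2 * t)))).
Proof.
have N0 : N.+1%:R != 0 :> R by rewrite pnatr_eq0.
apply: (mulfI N0); rewrite mulrBr /fejer_kernel !mulrA divff// !mul1r.
elim: N {N0} => [|N IH]; first by rewrite !big_ord_recr/= !big_ord0; ring.
rewrite big_ord_recr/= [in RHS]big_ord_recr/= [in RHS]mulrDr -IH dirichlet_kernelS -!natr1.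
by ring.
Qed.

(** With y = pi t / 2, both factors of sin (2 y) = 2 sin y cos y are controlled by
    cos >= 1/2 on [0, pi/4]: the second directly, the first by the mean value
    theorem. The constant is not sharp. *)
Lemma sin_pi_ge t : 0 <= t <= 2^-1 -> t / 2 <= sin (pi * t).
Proof.
move=> /andP[t0 t12].
have pi0 : 0 < pi :> R := pi_gt0 R.
have pi2 : 2 <= pi :> R := pi_ge2 R.
pose y := pi * t / 2.
have y0 : 0 <= y by rewrite /y divr_ge0// mulr_ge0// ltW.
have ypi : y *+ 2 <= pi / 2.
  by rewrite /y -mulr_natr divfK// ler_pM2l.
have cosy z : 0 <= z <= y -> 2^-1 <= cos z.
  move=> /andP[z0 zy].
  have cz0 : 0 <= cos z by apply: cos_ge0_pihalf; apply/andP; split; nra.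
  have : 0 <= cos (z *+ 2) by apply: cos_ge0_pihalf; apply/andP; split; nra.
  rewrite cos_mulr2n -mulr_natr; nra.
have siny : y / 2 <= sin y.
  move: y0; rewrite le_eqVlt => /predU1P[<-|y0]; first by rewrite sin0 mul0r.
  have [c] := @MVT _ (@sin R) cos 0 y y0 (fun x _ => is_derive_sin x)
    (continuous_subspaceT (@continuous_sin R)).
  rewrite in_itv/= => /andP[c0 cy]; rewrite sin0 !subr0 => ->.
  have cc : 2^-1 <= cos c by apply: cosy; rewrite !ltW.
  by rewrite mulrC ler_pM2r.
have -> : pi * t = y *+ 2 by rewrite /y -mulr_natr divfK.
have cy : 2^-1 <= cos y by apply: cosy; rewrite y0 lexx.
have yt : t <= y by rewrite /y; nra.
rewrite sin_mulr2n -mulr_natr; nra.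
Qed.

Lemma sin_pi_ge_min t : 0 <= t <= 1 -> Num.min t (1 - t) / 2 <= sin (pi * t).
Proof.
move=> /andP[t0 t1]; have [t12|t12] := leP t 2^-1.
  by rewrite (le_trans _ (sin_pi_ge _)) ?t0// ler_pM2r// ge_min lexx.
have -> : sin (pi * t) = sin (pi * (1 - t)).
  by rewrite mulrBr mulr1 sinB sinpi cospi; ring.
rewrite (le_trans _ (sin_pi_ge _))//; first by rewrite ler_pM2r// ge_min lexx orbT.
by apply/andP; split; lra.
Qed.

(** Where sin (pi t) vanishes, all the cosines are 1; elsewhere the closed form of
    [sin2_mul_sum_dirichlet] shows a quotient of squares. *)
Lemma fejer_kernel_ge0 N t : 0 <= fejer_kernel N t.
Proof.
rewrite mulr_ge0 ?invr_ge0//.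
have [s0|s0] := eqVneq (sin (pi * t)) 0; last first.
  rewrite -(@pmulr_rge0 _ (sin (pi * t) ^+ 2)); last by rewrite exprn_even_gt0.
  by rewrite sin2_mul_sum_dirichlet sqr_ge0.
have c1 : cos (pi *+ 2 * t) = 1.
  by rewrite mulrnAl cos_mulr2n cos2sin2 s0; ring.
have s1 : sin (pi *+ 2 * t) = 0 by rewrite mulrnAl sin_mulr2n s0 mulr0 mul0rn.
have ck k : cos (k%:R * (pi *+ 2 * t)) = 1.
  elim: k => [|k IH]; first by rewrite mul0r cos0.
  by rewrite -natr1 mulrDl mul1r cosD c1 s1 IH mulr0 subr0 mulr1.
apply: sumr_ge0 => s _; rewrite /dirichlet_kernel addr_ge0// mulr_ge0//.
by apply: sumr_ge0 => k _; rewrite ck.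
Qed.

(** The concentration of the Fejer kernel near the integers; with positivity and
    mean 1 it gives the convergence of the Fejer means. *)
Lemma sin2_mul_fejer_le N t :
  sin (pi * t) ^+ 2 * fejer_kernel N t <= N.+1%:R^-1.
Proof.
rewrite /fejer_kernel mulrCA sin2_mul_sum_dirichlet -[leRHS]mulr1.
by rewrite ler_pM2l ?invr_gt0// sqr_le1_norm.
Qed.

End kernels.

Lemma periodic_int (U V : zmodType) (f : U -> V) (T : U) :
  periodic f T -> forall (n : int) a, f (a + T *~ n) = f a.
Proof.
move=> pf [n|n] a; first exact: periodicn.
by rewrite NegzE mulrNz -[LHS](periodicn pf n.+1) -pmulrn subrK.
Qed.

(** * Calculus on the circle *)

Section circle_calculus.
Variable R : realType.
Notation lam := (@circle_measure R).
Notation leb := (@lebesgue_measure R).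

Lemma bmfun_continuous (f : R -> R) M : continuous f -> (forall x, `|f x| <= M) ->
  bmfun (f : measurableTypeR R -> R).
Proof.
move=> cf fM; split; last by exists M.
exact: continuous_measurable_fun.
Qed.

Lemma continuous_periodic_bounded (f : R -> R) : continuous f -> periodic f 1 ->
  exists M : R, forall x, `|f x| <= M.
Proof.
move=> cf pf.
have [M [_ fM]] : bounded_set (f @` `[0, 1]).
  apply: compact_bounded; apply: continuous_compact; last exact: segment_compact.
  exact: continuous_subspaceT.
exists (M + 1) => x.
have -> : f x = f (x - (Num.floor x)%:~R).
  by rewrite -[RHS](periodic_int pf (Num.floor x)) subrK.
apply: (fM (M + 1)); first by rewrite ltrDl.
exists (x - (Num.floor x)%:~R) => //=; rewrite in_itv/=.
have /andP[h1 h2] := floor_itv x.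
by rewrite subr_ge0 h1/= lerBlDl ltW// -intrD1 // addrC.
Qed.

Lemma Rintegral_shift (f : R -> R) a u v : u <= v -> continuous f ->
  \int[leb]_(s in `[u, v]) f (s + a) = \int[leb]_(s in `[u + a, v + a]) f s.
Proof.
move=> uv cf; rewrite /Rintegral; congr fine.
have dF (x : R) : is_derive x 1 (fun s : R => s + a) 1.
  by apply: is_derive_eq; rewrite addr0.
have F' : derive1 (fun s : R => s + a) = cst 1.
  by apply/funext => x; rewrite derive1E; exact: derive_val.
rewrite (@integration_by_substitution_increasing _ (fun s => s + a) f u v)//.
- by rewrite F'; apply: eq_integral => x _ /=; rewrite mulr1.
- by move=> x y _ _ xy; rewrite ltrD2r.
- by rewrite F' => x _; exact: cst_continuous.
- by rewrite F'; exact: is_cvg_cst.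
- by rewrite F'; exact: is_cvg_cst.
- have cF : continuous (fun s : R => s + a).
    by move=> x; apply: cvgD; [exact: cvg_id|exact: cvg_cst].
  split => //.
  + by apply: cvg_at_right_filter; exact: cF.
  + by apply: cvg_at_left_filter; exact: cF.
- exact: continuous_subspaceT.
Qed.

Lemma continuous_shift (f : R -> R) a : continuous f -> continuous (fun s => f (s + a)).
Proof.
move=> cf x; apply: (@continuous_comp _ _ _ (fun s => s + a) f); last exact: cf.
by apply: cvgD; [exact: cvg_id|exact: cvg_cst].
Qed.

(** For a shift in [0, 1] the integral over [a, 1 + a] is cut at 1 and the second
    piece is brought back by periodicity; the general case removes the integer
    part of the shift. *)
Lemma circle_shift (f : R -> R) a : continuous f -> periodic f 1 ->
  \int[lam]_s f (s + a) = \int[lam]_s f s.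
Proof.
move=> cf pf; have [M fM] := continuous_periodic_bounded cf pf.
have int_f u v : leb.-integrable `[u, v] (EFin \o f).
  apply: continuous_compact_integrable; first exact: segment_compact.
  exact: continuous_subspaceT.
have key (b : R) : 0 <= b <= 1 -> \int[lam]_s f (s + b) = \int[lam]_s f s.
  move=> /andP[b0 b1].
  have mf : measurable_fun setT f by exact: continuous_measurable_fun.
  have mfb : measurable_fun setT (fun s : R => f (s + b)).
    by apply: continuous_measurable_fun; exact: continuous_shift.
  rewrite !circle_mean// Rintegral_shift// add0r.
  have := @Rintegral_itvB _ f (BLeft 0) (BRight 1) b (int_f _ _).
  have := @Rintegral_itvB _ f (BLeft b) (BRight (1 + b)) 1 (int_f _ _).
  rewrite !bnd_simp b0 b1 lerDl b0 => /(_ isT isT) e1 /(_ isT isT) e2.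
  have e3 : \int[leb]_(x in `[1, 1 + b]) f x = \int[leb]_(x in `[0, b]) f x.
    have -> : `[1, 1 + b]%classic = `[0 + 1, b + 1]%classic by rewrite add0r addrC.
    rewrite -Rintegral_shift//.
    by apply: eq_Rintegral => x _; exact: pf.
  have int_oc u v : leb.-integrable `]u, v] (EFin \o f).
    by apply: integrableS (int_f u v) => //; exact: subset_itv_oc_cc.
  move: e1 e2; rewrite !Rintegral_itv_obnd_cbnd//.
  by move=> e1 e2; rewrite e3 in e1; lra.
have a01 : 0 <= a - (Num.floor a)%:~R <= 1.
  have /andP[h1 h2] := floor_itv a.
  by rewrite subr_ge0 h1/= lerBlDl ltW// -intrD1 // addrC.
rewrite -(key _ a01); apply: eq_Rintegral => s _.
by rewrite -[RHS](periodic_int pf (Num.floor a)) addrA subrK.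
Qed.

(** Applied with [H] a multiple of the conjugate kernel, which vanishes at the
    integers, so that no boundary term is left. *)
Lemma circle_by_parts (G g H h : R -> R) :
  (forall x : R, is_derive x 1 G (g x)) -> continuous g ->
  (forall x : R, is_derive x 1 H (h x)) -> continuous h -> H 0 = 0 -> H 1 = 0 ->
  \int[lam]_s (G s * h s) = - \int[lam]_s (g s * H s).
Proof.
move=> dG cg dH ch H0 H1.
have cont (F f : R -> R) : (forall x : R, is_derive x 1 F (f x)) -> continuous F.
  move=> dF x; apply: differentiable_continuous; apply/derivable1_diffP.
  exact: ex_derive.
have derE (F f : R -> R) : (forall x : R, is_derive x 1 F (f x)) -> derive1 F = f.
  by move=> dF; apply/funext => x; rewrite derive1E; exact: derive_val.
have LR (F f : R -> R) : (forall x : R, is_derive x 1 F (f x)) -> derivable_oo_LRcontinuous F 0 1.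
  move=> dF; have cF := cont _ _ dF; split => [x _||].
  - exact: ex_derive.
  - by apply: cvg_at_right_filter; exact: cF.
  - by apply: cvg_at_left_filter; exact: cF.
have cG := cont _ _ dG; have cH := cont _ _ dH.
rewrite !circle_mean; last 2 first.
- by apply: continuous_measurable_fun => x; apply: cvgM; [exact: cg|exact: cH].
- by apply: continuous_measurable_fun => x; apply: cvgM; [exact: cG|exact: ch].
rewrite (@Rintegration_by_parts _ G H g h 0 1)//.
- by rewrite H0 H1 !mulr0 subrr sub0r.
- exact: continuous_subspaceT.
- exact: LR dG.
- by move=> x _; rewrite (derE _ _ dG).
- exact: continuous_subspaceT.
- exact: LR dH.
- by move=> x _; rewrite (derE _ _ dH).
Qed.

(** The derivative is written in the shape of the right-hand side of
    [dirichlet_fejer]. *)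
Lemma is_derive_conj_dirichlet N (t : R) : is_derive t 1 (conj_dirichlet_kernel N)
  (2 * pi * (2 * \sum_(k < N) (k.+1%:R * cos (k.+1%:R * (pi *+ 2 * t))))).
Proof.
elim: N => [|N IH].
  rewrite /conj_dirichlet_kernel; under eq_fun do rewrite big_ord0 mulr0.
  by rewrite big_ord0 !mulr0; exact: is_derive_cst.
rewrite (_ : conj_dirichlet_kernel N.+1 = conj_dirichlet_kernel N \+
    (fun t => 2 * sin (N.+1%:R * (pi *+ 2 * t)))); last first.
  by apply/funext => x; rewrite conj_dirichlet_kernelS.
apply: is_derive_eq.
rewrite big_ord_recr/= /GRing.scale/=; ring.
Qed.

Lemma continuous_cos_freq (c : R) : continuous (fun t : R => cos (c * (pi *+ 2 * t))).
Proof.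
move=> x; apply: (@continuous_comp _ _ _ (fun t => c * (pi *+ 2 * t)) cos); last exact: continuous_cos.
by apply: cvgMr; apply: cvgMr; exact: cvg_id.
Qed.

Lemma continuous_sin_freq (c : R) : continuous (fun t : R => sin (c * (pi *+ 2 * t))).
Proof.
move=> x; apply: (@continuous_comp _ _ _ (fun t => c * (pi *+ 2 * t)) sin); last exact: continuous_sin.
by apply: cvgMr; apply: cvgMr; exact: cvg_id.
Qed.

Lemma continuous_sumr (I : Type) (s : seq I) (P : pred I) (F : I -> R -> R) :
  (forall i, continuous (F i)) -> continuous (fun x => \sum_(i <- s | P i) F i x).
Proof.
by move=> cF; apply: (@continuous_big R _ +%R 0 P (@add_continuous R)) => i _; exact: cF.
Qed.

Lemma continuous_dirichlet N : continuous (@dirichlet_kernel R N).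
Proof.
move=> x; apply: cvgD; first exact: cvg_cst.
by apply: cvgMr; apply: continuous_sumr => k; exact: continuous_cos_freq.
Qed.

Lemma continuous_conj_dirichlet N : continuous (@conj_dirichlet_kernel R N).
Proof.
move=> x; apply: cvgMr; apply: continuous_sumr => k; exact: continuous_sin_freq.
Qed.

Lemma continuous_fejer N : continuous (@fejer_kernel R N).
Proof.
move=> x; apply: cvgMr; apply: continuous_sumr => k; exact: continuous_dirichlet.
Qed.

Lemma norm_sum_le_size n (F : 'I_n -> R) M :
  (forall i, `|F i| <= M) -> `|\sum_(i < n) F i| <= M * n%:R.
Proof.
move=> FM; rewrite (le_trans (ler_norm_sum _ _ _))//.
by rewrite (le_trans (ler_sum _ (fun i _ => FM i)))// sumr_const card_ord mulr_natr.
Qed.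

Lemma dirichlet_le N t : `|@dirichlet_kernel R N t| <= N.*2.+1%:R.
Proof.
rewrite -natr1 addrC -mul2n natrM (le_trans (ler_normD _ _))// normr1 lerD2l.
rewrite normrM ger0_norm// ler_pM2l// -[leRHS]mul1r.
by apply: norm_sum_le_size => k; exact: cos_max.
Qed.

Lemma conj_dirichlet_le N t : `|@conj_dirichlet_kernel R N t| <= N.*2.+1%:R.
Proof.
rewrite -natr1 -mul2n natrM (@le_trans _ _ (2 * N%:R))// ?lerDl//.
rewrite normrM ger0_norm// ler_pM2l// -[leRHS]mul1r.
by apply: norm_sum_le_size => k; exact: sin_max.
Qed.

Lemma fejer_le N t : `|@fejer_kernel R N t| <= N.*2.+1%:R.
Proof.
rewrite normrM ger0_norm ?invr_ge0// ler_pdivrMl//.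
rewrite [leRHS]mulrC; apply: norm_sum_le_size => s.
by rewrite (le_trans (dirichlet_le _ _))// ler_nat !ltnS leq_double -ltnS.
Qed.

Lemma bmfun_dirichlet N : bmfun (@dirichlet_kernel R N : measurableTypeR R -> R).
Proof. by apply: bmfun_continuous (dirichlet_le N); exact: continuous_dirichlet. Qed.

Lemma bmfun_conj_dirichlet N : bmfun (@conj_dirichlet_kernel R N : measurableTypeR R -> R).
Proof. by apply: bmfun_continuous (conj_dirichlet_le N); exact: continuous_conj_dirichlet. Qed.

Lemma bmfun_fejer N : bmfun (@fejer_kernel R N : measurableTypeR R -> R).
Proof. by apply: bmfun_continuous (fejer_le N); exact: continuous_fejer. Qed.

Lemma sin_freq_int (k : nat) : sin (k%:R * (pi *+ 2 * 1)) = 0 :> R.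
Proof.
by rewrite mulr1 mulr_natl -[X in sin X]add0r (periodicn (@sinD2pi R)) sin0.
Qed.

Lemma circle_mean_cos k : \int[lam]_t cos (k.+1%:R * (pi *+ 2 * t)) = 0 :> R.
Proof.
pose c : R := k.+1%:R * (pi *+ 2).
have c0 : c != 0 by rewrite mulf_neq0// gt_eqF// mulrn_wgt0// pi_gt0.
have dH (x : R) : is_derive x 1 (fun t => c^-1 * sin (k.+1%:R * (pi *+ 2 * t)))
    (cos (k.+1%:R * (pi *+ 2 * x))).
  apply: is_derive_eq; rewrite /GRing.scale/=.
  by rewrite (mulr1 (pi *+ 2)) -/c mulrCA mulVf// mulr1.
have dG (x : R) : is_derive x 1 (cst 1 : R -> R) 0 by exact: is_derive_cst.
under eq_Rintegral do rewrite -[cos _]mul1r.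
rewrite (circle_by_parts dG _ dH (@continuous_cos_freq _)).
- by under eq_Rintegral do rewrite mul0r; rewrite mean_cst oppr0.
- exact: cst_continuous.
- by rewrite !mulr0 sin0 mulr0.
- by rewrite sin_freq_int mulr0.
Qed.

Lemma mean_dirichlet N : \int[lam]_t dirichlet_kernel N t = 1 :> R.
Proof.
have bc k : bmfun ((fun t => cos (k%:R * (pi *+ 2 * t))) : measurableTypeR R -> R).
  apply: bmfun_continuous; first exact: continuous_cos_freq.
  by move=> x; exact: cos_max.
rewrite meanD; [|exact: bmfun_cst|].
  rewrite mean_cst meanZl; last by apply: bmfun_sum => k; exact: bc.
  rewrite mean_sum; last by move=> k; exact: bc.
  by rewrite big1 ?mulr0 ?addr0// => k _; exact: circle_mean_cos.
by apply: bmfunM; [exact: bmfun_cst|apply: bmfun_sum => k; exact: bc].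
Qed.

Lemma mean_fejer N : \int[lam]_t fejer_kernel N t = 1 :> R.
Proof.
rewrite meanZl; last by apply: bmfun_sum => k; exact: bmfun_dirichlet.
rewrite mean_sum; last by move=> k; exact: bmfun_dirichlet.
under eq_bigr do rewrite mean_dirichlet.
by rewrite sumr_const card_ord mulVf.
Qed.

End circle_calculus.

(** * Lebesgue constants *)

Section lebesgue_constants.
Variable R : realType.
Notation lam := (@circle_measure R).
Notation leb := (@lebesgue_measure R).

Lemma le_circle_mean (f g : measurableTypeR R -> R) : bmfun f -> bmfun g ->
  (forall t, 0 <= t <= 1 -> f t <= g t) -> \int[lam]_t f t <= \int[lam]_t g t.
Proof.
have int01 (h : measurableTypeR R -> R) : bmfun h -> leb.-integrable `[0, 1] (EFin \o h).
  move=> [mh [M hM]]; apply: measurable_bounded_integrable => //.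
  - have l01 : leb `[0%R : R, 1%R : R]%classic = 1%E.
      by rewrite lebesgue_measure_itv/= lte01 oppr0 adde0.
    by rewrite [X in (X < _)%E](_ : _ = 1%E) ?ltry.
  - exact: measurable_funTS.
  - exists M; split; first exact: num_real.
    by move=> y My x _ /=; rewrite (le_trans (hM x))// ltW.
move=> bf bg fg; rewrite circle_mean; last by case: bf.
rewrite circle_mean; last by case: bg.
by apply: le_Rintegral => //; exact: int01.
Qed.

Lemma bmfun_indic (A : set (measurableTypeR R)) : measurable A -> bmfun (\1_A : _ -> R).
Proof.
move=> mA; split; first exact: measurable_indic.
by exists 1 => x; rewrite indicE; case: (_ \in _); rewrite ?normr1 ?normr0.
Qed.

Lemma circle_mean_indic_le (a b : R) : a <= b -> \int[lam]_t \1_`[a, b] t <= b - a.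
Proof.
move=> ab; have mab : measurable (`[a, b] : set (measurableTypeR R)) by [].
rewrite /Rintegral integral_indic// setIT.
have le1 : (lam `[a, b]%classic <= (b - a)%:E)%E.
  rewrite /= /circle_measure /mrestr.
  apply: le_trans (_ : leb `[a, b]%classic <= _)%E.
    by apply: le_measure; rewrite ?inE//; exact: measurableI.
  rewrite lebesgue_measure_itv/= lte_fin; case: ifPn => // _.
  by rewrite lee_fin subr_ge0.
by rewrite -lee_fin fineK// ge0_fin_numE// (le_lt_trans le1)// ltry.
Qed.

(** On [0, 1], a step function comparable to the inverse of the distance from [t]
    to the endpoints, truncated at a height of order [2 ^+ m]: each of its
    [m.+1] dyadic layers has the same mass, hence a mean linear in [m]. *)
Definition dyadic_bound (m : nat) (t : R) : R :=
  \sum_(k < m.+1) 2 ^+ (k + 3) *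
    (\1_`[0, 2 ^- k] t + \1_`[1 - 2 ^- k, 1] t).

(** By induction on [m]: within distance 2^-(m+1) of the endpoints the last layer
    dominates the truncation level; farther away, q is below the previous
    truncation level. *)
Lemma le_dyadic_bound (m : nat) (t q : R) : 0 <= t <= 1 -> q <= 8 * 2 ^+ m ->
  q * Num.min t (1 - t) <= 4 -> q <= dyadic_bound m t.
Proof.
move=> t01 + qu; move: (t01) => /andP[t0 t1].
set u := Num.min t (1 - t) in qu *.
have u0 : 0 <= u by rewrite le_min t0 subr_ge0.
have ind k : u <= 2 ^- k -> 1 <= \1_`[0, 2 ^- k] t + \1_`[1 - 2 ^- k, 1] t :> R.
  rewrite ge_min => /orP[h|h].
    by rewrite [X in _ <= X + _]indicE mem_set ?lerDl//= in_itv/= t0.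
  by rewrite [X in _ <= _ + X]indicE mem_set ?lerDr//= in_itv/= t1 andbT; lra.
have pos k : 0 <= 2 ^+ (k + 3) * (\1_`[0, 2 ^- k] t + \1_`[1 - 2 ^- k, 1] t) :> R.
  by rewrite mulr_ge0 ?exprn_ge0// addr_ge0.
elim: m => [|m IH].
  rewrite expr0 mulr1 => q8; rewrite /dyadic_bound big_ord_recr big_ord0/= add0r.
  rewrite (le_trans q8)// add0n (_ : 2 ^+ 3 = 8 :> R); last by ring.
  by rewrite ler_peMr// ind// expr0 invr1 /u ge_min t1.
move=> qm; rewrite /dyadic_bound big_ord_recr/=.
have [um|um] := leP u (2 ^- m.+1).
  rewrite -[leLHS]add0r lerD//; first by apply: sumr_ge0 => k _; exact: pos.
  rewrite (le_trans qm)// exprD (_ : 2 ^+ 3 = 8 :> R); last by ring.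
  rewrite mulrC ler_peMr ?ind// mulr_ge0// exprn_ge0//.
rewrite -[leLHS]addr0 lerD//; apply: IH.
have p0 : 0 < 2 ^+ m.+1 :> R by rewrite exprn_gt0.
have [q0|q0] := leP q 0; first by rewrite (le_trans q0)// mulr_ge0// exprn_ge0.
have : q * 2 ^- m.+1 <= 4 by rewrite (le_trans _ qu)// ler_pM2l// ltW.
by rewrite ler_pdivrMr// exprS; lra.
Qed.

Lemma bmfun_dyadic m : bmfun (dyadic_bound m : measurableTypeR R -> R).
Proof.
apply: bmfun_sum => k; apply: bmfunM; first exact: bmfun_cst.
by apply: bmfunD; exact: bmfun_indic.
Qed.

Lemma mean_dyadic m : \int[lam]_t dyadic_bound m t <= 16 * m.+1%:R.
Proof.
have bi (k : nat) : bmfun ((fun t : R => \1_`[0, 2 ^- k] t + \1_`[1 - 2 ^- k, 1] t : R)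
    : measurableTypeR R -> R).
  by apply: bmfunD; exact: bmfun_indic.
rewrite mean_sum; last by move=> k; apply: bmfunM; [exact: bmfun_cst|exact: bi].
have -> : 16 * m.+1%:R = \sum_(k < m.+1) 16 :> R.
  by rewrite sumr_const card_ord mulr_natr.
apply: ler_sum => k _.
rewrite meanZl ?meanD; [|exact: bmfun_indic|exact: bmfun_indic|exact: bi].
have p0 : 0 < 2 ^- k :> R by rewrite invr_gt0 exprn_gt0.
have h1 := circle_mean_indic_le (ltW p0).
have h2 := @circle_mean_indic_le (1 - 2 ^- k) 1.
have {}h2 := h2 ltac:(lra).
rewrite (@le_trans _ _ (2 ^+ (k + 3) * (2 * 2 ^- k)))//.
  by rewrite ler_pM2l ?exprn_gt0//; lra.
by rewrite exprD (_ : 2 ^+ 3 = 8 :> R); [rewrite mulrCA mulrAC divff ?expf_neq0//; lra|ring].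
Qed.

(** The common source of the logarithmic bounds: a kernel bounded by both 2^m and
    1 / sin (pi t), up to constants, has L^1 norm of order m. *)
Lemma mean_le_dyadic (Q : measurableTypeR R -> R) m : bmfun Q ->
  (forall t, `|Q t| <= 8 * 2 ^+ m) -> (forall t, `|sin (pi * t) * Q t| <= 2) ->
  \int[lam]_t `|Q t| <= 16 * m.+1%:R.
Proof.
move=> bQ Qm Qs; rewrite (le_trans _ (mean_dyadic m))//.
apply: le_circle_mean; [exact: bmfun_norm|exact: bmfun_dyadic|].
move=> t t01; apply: le_dyadic_bound => //.
have := Qs t; rewrite normrM => h.
have := sin_pi_ge_min t01; have := ler_norm (sin (pi * t)).
have := normr_ge0 (Q t); nra.
Qed.

(** In terms of this scale the bounds on the Lebesgue constants are affine and the
    one-coordinate error decays like [2 ^- log4 N], without real logarithms or square roots. *)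
Definition log4 (N : nat) : nat := trunc_log 4 N.+1.

Definition lebesgue_bound (N : nat) : R := 16 * (log4 N).*2.+1%:R.

Lemma log4_lb N : (4 ^ log4 N <= N.+1)%N.
Proof. exact: trunc_logP. Qed.

Lemma log4_ub N : (N.+1 < 4 ^ (log4 N).+1)%N.
Proof. exact: trunc_log_ltn. Qed.

Lemma size_kernel_le_pow2 N : N.*2.+1%:R <= 8 * 2 ^+ (log4 N).*2 :> R.
Proof.
rewrite -natrX -natrM ler_nat.
have -> : (8 * 2 ^ (log4 N).*2 = 2 * 4 ^ (log4 N).+1)%N.
  by rewrite -mul2n expnM [in RHS]expnS mulnA.
have := log4_ub N; rewrite -mul2n; lia.
Qed.

Lemma mean_norm_dirichlet N : \int[lam]_t `|dirichlet_kernel N t| <= lebesgue_bound N.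
Proof.
apply: mean_le_dyadic; first exact: bmfun_dirichlet.
  by move=> t; rewrite (le_trans (dirichlet_le _ _))// size_kernel_le_pow2.
by move=> t; rewrite sin_mul_dirichlet (le_trans (sin_max _))// ler1n.
Qed.

Lemma mean_norm_conj_dirichlet N :
  \int[lam]_t `|conj_dirichlet_kernel N t| <= lebesgue_bound N.
Proof.
apply: mean_le_dyadic; first exact: bmfun_conj_dirichlet.
  by move=> t; rewrite (le_trans (conj_dirichlet_le _ _))// size_kernel_le_pow2.
move=> t; rewrite sin_mul_conj_dirichlet (le_trans (ler_normB _ _))//.
by rewrite (_ : 2 = 1 + 1)// lerD// cos_max.
Qed.

Lemma lebesgue_bound_ge1 N : 1 <= lebesgue_bound N.
Proof. by rewrite /lebesgue_bound -natrM ler1n. Qed.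

End lebesgue_constants.

(** * Continuous functions on the torus *)

Section point_topology.
Variables (R : realType) (d : nat).
Notation point := ('rV[R]_d * 'rV[R]_d)%type.
Implicit Types (p q : point) (c : 'I_d + 'I_d).

(** Neighborhoods in terms of the coordinates of the torus, which hides the two
    blocks of variables. *)
Lemma nbhs_pointP p (U : set point) : nbhs p U ->
  exists2 e : R, 0 < e & forall q, (forall c, `|pcoord c p - pcoord c q| < e) -> U q.
Proof.
move=> /nbhs_ballP[e /= e0 eU]; exists e => // q pq; apply: eU.
split; split => // i j; rewrite (ord1 i) -ball_normE /=.
- exact: (pq (inl j)).
- exact: (pq (inr j)).
Qed.

Lemma continuous_pcoord c : continuous (@pcoord R d c).
Proof.
case: c => i p.
- apply: (@continuous_comp _ _ _ fst (fun x : 'rV[R]_d => x ord0 i)); first exact: cvg_fst.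
  exact: coord_continuous.
- apply: (@continuous_comp _ _ _ snd (fun x : 'rV[R]_d => x ord0 i)); first exact: cvg_snd.
  exact: coord_continuous.
Qed.

(** An open set is the union of the boxes with rational centers and radii
    [n.+1%:R^-1] that it contains, and these are countably many. *)
Lemma open_point_measurable (U : set point) : open U -> measurable U.
Proof.
move=> oU.
pose box (b : {ffun 'I_d + 'I_d -> rat} * nat) : set point :=
  [set q | forall c, `|ratr (b.1 c) - pcoord c q| < b.2.+1%:R^-1].
have mbox b : measurable (box b).
  rewrite (_ : box b = \bigcap_c
      (pcoord c @^-1` (ball (ratr (b.1 c) : R) b.2.+1%:R^-1))); last first.
    apply/seteqP; split=> [q bq c _|q bq c].
      by rewrite /= -ball_normE; exact: bq.
    by have := bq c I; rewrite /= -ball_normE.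
  apply: fin_bigcap_measurable; first exact: finite_finset.
  by move=> c _; rewrite -[X in measurable X]setTI; apply: measurable_pcoord => //; exact: measurable_ball.
rewrite (_ : U = \bigcup_b (if `[< box b `<=` U >] then box b else set0)).
  apply: countable_bigcupT_measurable; first exact: countableP.
  by move=> b; case: ifP.
apply/seteqP; split=> [p Up|p [b _]]; last by case: ifPn => // /asboolP; exact.
have [e e0 eU] := nbhs_pointP (open_nbhs_nbhs (conj oU Up)).
have [n ne] : exists n : nat, n.+1%:R^-1 < e / 2.
  have e20 : 0 < e / 2 by rewrite divr_gt0.
  near \oo => n; exists n; near: n; exact: near_infty_natSinv_lt (PosNum e20).
have /choice[f fP] c : exists r : rat, `|ratr r - pcoord c p| < n.+1%:R^-1.
  have /rat_in_itvoo[r] : pcoord c p - n.+1%:R^-1 < pcoord c p + n.+1%:R^-1.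
    by rewrite ltrBlDr -addrA ltrDl addr_gt0// invr_gt0.
  rewrite in_itv/= => /andP[r1 r2]; exists r.
  by rewrite ltr_norml ltrBrDl r1 ltrBlDl r2.
exists ([ffun c => f c], n) => //.
have bp : box ([ffun c => f c], n) p by move=> c; rewrite /= ffunE.
rewrite ifT//; apply/asboolP => q bq; apply: eU => c.
have := bq c; have := bp c; rewrite /= ffunE => h1 h2.
rewrite -(subrKA (ratr (f c))) (le_lt_trans (ler_normD _ _))// distrC.
by rewrite (lt_le_trans (ltrD h1 h2))// (splitr e) lerD// ltW.
Unshelve. all: by end_near. Qed.

Lemma continuous_point_measurable (G : point -> R) : continuous G -> measurable_fun setT G.
Proof.
move=> cG; apply: (measurability _ (RGenOpens.measurableE R)).
move=> /= _ [_ [a [b ->] <-]]; rewrite setTI; apply: open_point_measurable.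
by apply: (open_comp (fun x _ => cG x)); exact: interval_open.
Qed.

Lemma compact_point_box (a b : R) :
  compact [set p : point | forall c, a <= pcoord c p <= b].
Proof.
have cV : compact [set x : 'rV[R]_d | forall i, `[a, b]%classic (x ord0 i)].
  by apply: (@rV_compact R d (fun=> `[a, b]%classic)) => i; exact: segment_compact.
rewrite (_ : mkset _ = [set x : 'rV[R]_d | forall i, `[a, b]%classic (x ord0 i)] `*`
   [set x : 'rV[R]_d | forall i, `[a, b]%classic (x ord0 i)]); first exact: compact_setX.
apply/seteqP; split => [p h|p [h1 h2] [] i].
- split => i /=; rewrite in_itv/=; [exact: (h (inl i))|exact: (h (inr i))].
- by have := h1 i; rewrite /= in_itv.
- by have := h2 i; rewrite /= in_itv.
Qed.

End point_topology.

Section torus_functions.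
Variables (R : realType) (d : nat).
Notation point := ('rV[R]_d * 'rV[R]_d)%type.
Implicit Types (p q : point) (c : 'I_d + 'I_d) (G : point -> R).

Lemma torus_fun_int G p q : torus_fun G ->
  (forall c, exists n : int, pcoord c p = pcoord c q + n%:~R) -> G p = G q.
Proof.
move=> pG /choice[n pq].
have -> : p = q + \sum_c (direction c *~ n c).
  rewrite -[p](subrKC q) [in LHS](point_sum_direction (p - q)); congr (_ + _).
  by apply: eq_bigr => c _; rewrite -scaler_int pcoordB pq addrC addKr.
elim/big_rec : _ => [|c p' _ IH]; first by rewrite addr0.
by rewrite [_ *~ _ + p']addrC addrA (periodic_int (pG c)).
Qed.

Definition fracp p : point :=
  mkpoint (fun c => pcoord c p - (Num.floor (pcoord c p))%:~R).

Lemma pcoord_fracp c p : pcoord c (fracp p) = pcoord c p - (Num.floor (pcoord c p))%:~R.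
Proof. exact: pcoord_mkpoint. Qed.

Lemma fracp_box p c : 0 <= pcoord c (fracp p) <= 1.
Proof.
rewrite pcoord_fracp; have /andP[h1 h2] := floor_itv (pcoord c p).
by rewrite subr_ge0 h1/= lerBlDl ltW// -intrD1 // addrC.
Qed.

Lemma torus_fun_fracp G p q : torus_fun G -> G (fracp p + q) = G (p + q).
Proof.
move=> pG; apply: torus_fun_int => // c; exists (- Num.floor (pcoord c p)).
by rewrite !pcoordD pcoord_fracp mulrNz addrAC.
Qed.

Lemma torus_fun_bounded G : torus_fun G -> continuous G ->
  exists M : R, forall p, `|G p| <= M.
Proof.
move=> pG cG.
have [M [_ GM]] : bounded_set (G @` [set p : point | forall c, 0 <= pcoord c p <= 1]).
  apply: compact_bounded; apply: continuous_compact; last exact: compact_point_box.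
  exact: continuous_subspaceT.
exists (M + 1) => p; rewrite -[p]addr0 -torus_fun_fracp// addr0.
apply: (GM (M + 1)); first by rewrite ltrDl.
by exists (fracp p) => //; exact: fracp_box.
Qed.

Lemma bmfun_torus_fun G : torus_fun G -> continuous G -> bmfun G.
Proof.
move=> pG cG; split; first exact: continuous_point_measurable.
exact: torus_fun_bounded.
Qed.

(** The near-covering form of compactness, on the unit cube and with the increment
    [h] as parameter, gives a uniform [r]; periodicity extends it to all points. *)
Lemma torus_fun_unif_continuous G c (e : R) : torus_fun G -> continuous G -> 0 < e ->
  exists2 r : R, 0 < r & forall p (h : R), `|h| < r ->
    `|G (p + h *: direction c) - G p| < e.
Proof.
move=> pG cG e0.
have cF : continuous (fun z : point * R => z.1 + z.2 *: direction c).
  move=> z; apply: cvgD; first exact: cvg_fst.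
  by apply: cvgZr_tmp; exact: cvg_snd.
have /compact_near_coveringP/(_ R (nbhs (0 : R))
    (fun h p => `|G (p + h *: direction c) - G p| < e)) := @compact_point_box R d 0 1.
case.
  move=> p _.
  have cGF : continuous (fun z : point * R => G (z.1 + z.2 *: direction c) - G z.1).
    move=> z; apply: cvgB.
      by apply: (@continuous_comp _ _ _ (fun z : point * R => z.1 + z.2 *: direction c) G);
        [exact: cF|exact: cG].
    by apply: (@continuous_comp _ _ _ fst G); [exact: cvg_fst|exact: cG].
  have e1 : G (p + (0 : R) *: direction c) - G p = 0 by rewrite scale0r addr0 subrr.
  have : G (z.1 + z.2 *: direction c) - G z.1 @[z --> (p, 0 : R)] --> (0 : R).
    by have := cGF (p, 0 : R); rewrite /continuous_at [G _ - G _]e1.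
  by move/cvgr0_norm_lt => /(_ _ e0).
move=> r /= r0 h; exists r => // p s sr.
have e2 q : G (p + q) = G (fracp p + q) by rewrite torus_fun_fracp.
rewrite e2 -[in G p](addr0 p) e2 addr0.
apply: h; last by move=> c'; exact: fracp_box.
by rewrite /ball_ /= sub0r normrN.
Qed.

Lemma torus_fun_derive G c : torus_fun G -> torus_fun (fun p => 'D_(direction c) G p).
Proof.
move=> pG c' p; rewrite /derive.
suff -> : (fun h : R => h^-1 *: ((G \o shift (p + direction c')) (h *: direction c) -
      G (p + direction c'))) =
    (fun h => h^-1 *: ((G \o shift p) (h *: direction c) - G p)) by [].
by apply/funext => h; rewrite /= addrA !pG.
Qed.

Lemma torus_fun_pderiv G s : torus_fun G -> torus_fun (pderiv s G).
Proof. by move=> pG; elim: s => //= c s IH; exact: torus_fun_derive. Qed.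

Lemma is_derive_line G p c (t : R) : derivable G (p + t *: direction c) (direction c) ->
  is_derive t 1 (fun s : R => G (p + s *: direction c))
    ('D_(direction c) G (p + t *: direction c)).
Proof.
set e := direction c => dG.
have E : (fun h : R => h^-1 *: (((fun s : R => G (p + s *: e)) \o shift t) (h *: 1)
      - G (p + t *: e))) =
    (fun h => h^-1 *: ((G \o shift (p + t *: e)) (h *: e) - G (p + t *: e))).
  apply/funext => h /=; congr (_ *: (G _ - _)).
  have -> : h *: (1 : R) = h by rewrite /GRing.scale/= mulr1.
  by rewrite scalerDl addrCA.
by split; rewrite /derivable /derive E.
Qed.

End torus_functions.

(** * Convolution with a product kernel *)

Section convolution.
Variables (R : realType) (d : nat).
Notation point := ('rV[R]_d * 'rV[R]_d)%type.
Notation lam := (@circle_measure R).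
Notation mu2 := (@torus2_measure R d).
Implicit Types (p q t : point) (c : 'I_d + 'I_d) (G H : point -> R) (k : R -> R).

Lemma measurable_pointD p : measurable_fun setT (fun t : point => p + t).
Proof.
apply: measurable_fun_point => c; under eq_fun do rewrite pcoordD.
apply: measurable_funD; first exact: measurable_cst.
exact: measurable_pcoord.
Qed.

(** The kernels in use are even, so [p + s] is equivalent to the usual [p - s] and
    avoids sign changes. *)
Definition axis_conv k c G p : R := \int[lam]_s (k s * G (p + s *: direction c)).

Lemma bmfun_axis_conv_integrand k c G : bmfun (k : measurableTypeR R -> R) -> bmfun G ->
  bmfun (fun z : point * measurableTypeR R => k z.2 * G (z.1 + z.2 *: direction c)).
Proof.
move=> bk bG; apply: bmfunM.
  by apply: (bmfun_comp bk); exact: measurable_snd.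
apply: (bmfun_comp bG); apply: measurable_fun_point => c'.
under eq_fun do rewrite pcoordD pcoordZ.
apply: measurable_funD; first exact: measurableT_comp (measurable_pcoord c') measurable_fst.
by apply: measurable_funM; [exact: measurable_snd|exact: measurable_cst].
Qed.

Lemma bmfun_axis_conv k c G : bmfun (k : measurableTypeR R -> R) -> bmfun G ->
  bmfun (axis_conv k c G).
Proof.
by move=> bk bG; apply: (bmfun_mean2 mu2 lam (bmfun_axis_conv_integrand c bk bG)).
Qed.

Lemma bmfun_axis_conv_section k c G p : bmfun (k : measurableTypeR R -> R) -> bmfun G ->
  bmfun ((fun s => k s * G (p + s *: direction c)) : measurableTypeR R -> R).
Proof.
by move=> bk bG; exact: (bmfun_section2 p (bmfun_axis_conv_integrand c bk bG)).
Qed.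

Lemma axis_convB k c G H p : bmfun (k : measurableTypeR R -> R) -> bmfun G -> bmfun H ->
  axis_conv k c (fun q => G q - H q) p = axis_conv k c G p - axis_conv k c H p.
Proof.
move=> bk bG bH; rewrite /axis_conv -meanB; try exact: bmfun_axis_conv_section.
by apply: eq_Rintegral => s _; rewrite mulrBr.
Qed.

Lemma axis_conv_le k c G (l M : R) : bmfun (k : measurableTypeR R -> R) -> bmfun G ->
  0 <= M -> \int[lam]_s `|k s| <= l -> (forall p, `|G p| <= M) ->
  forall p, `|axis_conv k c G p| <= l * M.
Proof.
move=> bk bG M0 kl GM p.
rewrite (le_trans (le_norm_mean _ _))//; first exact: bmfun_axis_conv_section.
apply: le_trans (ler_wpM2r M0 kl); rewrite -meanZr; last exact: bmfun_norm.
apply: le_mean.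
- by apply: bmfun_norm; exact: bmfun_axis_conv_section.
- by apply: bmfunM; [exact: bmfun_norm|exact: bmfun_cst].
- by move=> s; rewrite normrM ler_wpM2l.
Qed.

Variable kap : 'I_d + 'I_d -> R -> R.
Hypothesis bkap : forall c, bmfun (kap c : measurableTypeR R -> R).

(** The convolution along the head of [s] is the innermost one, performed first. *)
Definition axis_convs (s : seq ('I_d + 'I_d)) G :=
  foldl (fun H c => axis_conv (kap c) c H) G s.

Lemma axis_convsB s G H p : bmfun G -> bmfun H ->
  axis_convs s (fun q => G q - H q) p = axis_convs s G p - axis_convs s H p.
Proof.
elim: s G H => //= c s IH G H bG bH.
rewrite -IH; [|exact: bmfun_axis_conv..].
by congr (axis_convs s _ p); apply/funext => q; exact: axis_convB.
Qed.

Lemma axis_convs_le s G (l : 'I_d + 'I_d -> R) (M : R) : bmfun G -> 0 <= M ->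
  (forall c, \int[lam]_s `|kap c s| <= l c) -> (forall p, `|G p| <= M) ->
  forall p, `|axis_convs s G p| <= (\prod_(c <- s) l c) * M.
Proof.
move=> bG M0 kl; have l0 c : 0 <= l c.
  by apply: le_trans (kl c); apply: Rintegral_ge0.
elim: s G M M0 bG => [|c s IH] G M M0 bG GM p; first by rewrite big_nil mul1r.
rewrite big_cons [l c * _]mulrC -mulrA; apply: IH.
- by rewrite mulr_ge0.
- exact: bmfun_axis_conv.
- exact: axis_conv_le.
Qed.

Definition restrict_coords (s : seq ('I_d + 'I_d)) t : point :=
  mkpoint (fun c => if c \in s then pcoord c t else 0).

Lemma bmfun_axis_convs_integrand s G p : bmfun G ->
  bmfun (fun t : point => (\prod_(c <- s) kap c (pcoord c t)) * G (p + restrict_coords s t)).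
Proof.
move=> bG; apply: bmfunM.
  by apply: bmfun_prod => c; apply: (bmfun_comp (bkap c)); exact: measurable_pcoord.
apply: (bmfun_comp bG); apply: measurable_fun_point => c.
under eq_fun do rewrite pcoordD pcoord_mkpoint.
apply: measurable_funD; first exact: measurable_cst.
by case: (c \in s); [exact: measurable_pcoord|exact: measurable_cst].
Qed.

(** Successive convolutions along distinct coordinates form one integral over the
    whole torus: the head coordinate is integrated out by [torus2_resample], as the
    remaining factors do not depend on it. *)
Lemma axis_convsE s G p : uniq s -> bmfun G ->
  axis_convs s G p =
  \int[mu2]_t ((\prod_(c <- s) kap c (pcoord c t)) * G (p + restrict_coords s t)).
Proof.
elim: s G => [|c s IH] G /=.
  move=> _ bG; rewrite -[LHS](mean_cst mu2); apply: eq_Rintegral => t _.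
  rewrite big_nil mul1r; congr G; apply: point_eqP => c.
  by rewrite pcoordD pcoord_mkpoint addr0.
move=> /andP[cs us] bG; rewrite IH//; last exact: bmfun_axis_conv.
rewrite [RHS](torus2_resample c); last exact: (bmfun_axis_convs_integrand (c :: s)).
apply: eq_Rintegral => t _; rewrite -meanZl; last exact: bmfun_axis_conv_section.
apply: eq_Rintegral => a _; rewrite mulrCA mulrA big_cons set_pcoordE eqxx.
congr (_ * _ * G _).
  rewrite big_seq [RHS]big_seq; apply: eq_bigr => c' c's; rewrite set_pcoordE.
  by case: eqVneq c's => // ->; rewrite (negbTE cs).
apply: point_eqP => c'.
rewrite !pcoordD !pcoord_mkpoint pcoordZ pcoord_direction set_pcoordE inE.
case: eqVneq => [->|]; first by rewrite (negbTE cs) addr0 mulr1.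
by rewrite mulr0 addr0.
Qed.

Definition prod_kernel t : R := \prod_c kap c (pcoord c t).

Definition torus_conv G p : R := \int[mu2]_t (prod_kernel t * G (p + t)).

Lemma bmfun_prod_kernel : bmfun prod_kernel.
Proof.
by apply: bmfun_prod => c; apply: (bmfun_comp (bkap c)); exact: measurable_pcoord.
Qed.

Lemma bmfun_torus_conv_integrand G p : bmfun G ->
  bmfun (fun t => prod_kernel t * G (p + t)).
Proof.
move=> bG; apply: bmfunM; first exact: bmfun_prod_kernel.
by apply: (bmfun_comp bG); exact: measurable_pointD.
Qed.

Lemma torus_conv_axis_convs s G p : uniq s -> (forall c, c \in s) -> bmfun G ->
  torus_conv G p = axis_convs s G p.
Proof.
move=> us sT bG; rewrite axis_convsE//; apply: eq_Rintegral => t _.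
congr (_ * G (p + _)).
  apply: perm_big; apply: uniq_perm => //.
    exact: index_enum_uniq.
  by move=> c; rewrite sT mem_index_enum.
by apply: point_eqP => c; rewrite pcoord_mkpoint sT.
Qed.

(** The convolutions T_c are performed in decreasing order of the bounds [l]. Since
    T_s (T_c G) - G = T_s (T_c G - G) + (T_s G - G), the error [e c] is amplified
    by the norms of the operators in [s] only, each of which is at most [l c]. *)
Lemma torus_conv_error G (l e : 'I_d + 'I_d -> R) : bmfun G ->
  (forall c, 1 <= l c) -> (forall c, \int[lam]_s `|kap c s| <= l c) ->
  (forall c p, `|axis_conv (kap c) c G p - G p| <= e c) ->
  forall p, `|torus_conv G p - G p| <= \sum_c l c ^+ (d + d) * e c.
Proof.
move=> bG l1 kl ke p.
have l0 c : 0 <= l c by rewrite (le_trans _ (l1 c)).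
have e0 c : 0 <= e c by rewrite (le_trans _ (ke c 0)).
pose r c c' := l c' <= l c.
have rT : total r by move=> c c'; exact: le_total.
have rtr : transitive r by move=> a b c ab bc; exact: le_trans bc ab.
pose s := sort r (enum {: 'I_d + 'I_d}).
have us : uniq s by rewrite sort_uniq enum_uniq.
have ss : sorted r s by exact: sort_sorted.
have perms : perm_eq s (index_enum ('I_d + 'I_d)%type).
  apply: uniq_perm => //; first exact: index_enum_uniq.
  by move=> c; rewrite mem_sort mem_enum mem_index_enum.
rewrite (@torus_conv_axis_convs s)//; last by move=> c; rewrite mem_sort mem_enum.
rewrite -(perm_big _ perms) /=.
have : (size s <= d + d)%N.
  by rewrite size_sort -cardE card_sum !card_ord.
elim: {us perms} s ss => [|c s IH] ss szs.
  by rewrite big_nil /= subrr normr0.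
rewrite big_cons /=.
have -> : axis_convs s (axis_conv (kap c) c G) p - G p =
    axis_convs s (fun q => axis_conv (kap c) c G q - G q) p + (axis_convs s G p - G p).
  by rewrite axis_convsB//; [rewrite addrA subrK|exact: bmfun_axis_conv].
rewrite (le_trans (ler_normD _ _))// lerD//; last first.
  by apply: IH; [exact: path_sorted ss|exact: leq_trans (leqnSn _) szs].
rewrite (le_trans (axis_convs_le (l := l) (M := e c) _ _ _ _ _ _))//.
  by apply: bmfunB => //; exact: bmfun_axis_conv.
rewrite ler_wpM2r//.
have : all (r c) s by apply: order_path_min ss.
have {szs} : (size s <= d + d)%N by exact: ltnW.
elim: s {IH ss} (d + d)%N => [|c' s IH] n /=.
  by rewrite big_nil => _ _; exact: exprn_ege1.
case: n => // n sn /andP[cc' cs]; rewrite big_cons exprS ler_pM//.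
  by rewrite prodr_ge0.
exact: IH.
Qed.

(** Differentiation under the integral sign; periodicity and continuity make the
    derivative bounded, which provides the domination. *)
Lemma is_derive_torus_conv G c p : torus_fun G -> continuous G ->
  (forall q, derivable G q (direction c)) ->
  continuous (fun q => 'D_(direction c) G q) ->
  is_derive p (direction c) (torus_conv G) (torus_conv (fun q => 'D_(direction c) G q) p).
Proof.
move=> pG cG dG cdG; set e := direction c.
have bG := bmfun_torus_fun pG cG.
have bdG := bmfun_torus_fun (torus_fun_derive c pG) cdG.
have [_ [M kM]] := bmfun_prod_kernel.
have [_ [N GN]] := bdG.
pose f (tau : R) t := prod_kernel t * G (p + t + tau *: e).
have df (tau : R) t : is_derive tau 1 (f ^~ t)
    (prod_kernel t * 'D_e G (p + t + tau *: e)).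
  have := is_derive_line (dG (p + t + tau *: e)) => dl.
  by apply: is_derive_eq; rewrite /GRing.scale/= -/e.
have fE (tau : R) : f tau = fun t => prod_kernel t * G ((p + tau *: e) + t).
  by apply/funext => t; rewrite /f addrAC.
have int_f (x : R) : x \in `]-1, 1[ -> mu2.-integrable setT (EFin \o f x).
  by move=> _; rewrite fE; apply: bmfun_integrable; exact: bmfun_torus_conv_integrand.
have der_f (x : R) t : x \in `]-1, 1[ -> setT t -> derivable (f ^~ t) x 1.
  by move=> _ _; have dft := df x t; exact: ex_derive.
have f_le (x : R) t : x \in `]-1, 1[ -> setT t -> `|partial1of2 f x t| <= `|M| * `|N|.
  move=> _ _; have dft := df x t; rewrite partial1of2E derive_val normrM ler_pM//.
  - by rewrite (le_trans (kM t))// ler_norm.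
  - by rewrite (le_trans (GN _))// ler_norm.
have itv0 : (0 : R) \in `]-1, 1[ by rewrite in_itv/= ltrN10 ltr01.
have key := @cvg_differentiation_under_integral R _ _ mu2 f setT measurableT 0 (-1) 1
  itv0 int_f der_f (cst (`|M| * `|N|)) (fun=> mulr_ge0 (normr_ge0 _) (normr_ge0 _))
  (bmfun_integrable _ (bmfun_cst _ _)) f_le.
have E : (fun h : R => h^-1 *: ((torus_conv G \o shift p) (h *: e) - torus_conv G p)) =
    (fun h => h^-1 *: (\int[mu2]_t f (h + 0) t - \int[mu2]_t f 0 t)).
  by apply/funext => h; rewrite !fE /= addr0 scale0r addr0 [_ + p]addrC.
have V : \int[mu2]_t partial1of2 f 0 t = torus_conv (fun q => 'D_e G q) p.
  apply: eq_Rintegral => t _; have dft := df 0 t; rewrite partial1of2E derive_val.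
  by rewrite scale0r addr0.
rewrite V -E in key.
split; last exact/cvg_lim.
by apply/cvg_ex; eexists; exact: key.
Qed.

End convolution.

(** * Approximation in one coordinate *)

Section approximation.
Variables (R : realType) (d : nat).
Notation point := ('rV[R]_d * 'rV[R]_d)%type.
Notation lam := (@circle_measure R).
Implicit Types (p q : point) (c : 'I_d + 'I_d) (G K : point -> R).

Lemma pderiv_torus_conv_sub (kap : 'I_d + 'I_d -> R -> R) k K (s : seq ('I_d + 'I_d)) :
  (forall c, bmfun (kap c : measurableTypeR R -> R)) ->
  torus_fun K -> Ck k K -> (size s <= k)%N ->
  pderiv s (fun p => torus_conv kap K p - K p) =
  fun p => torus_conv kap (pderiv s K) p - pderiv s K p.
Proof.
move=> bkap pK CK; elim: s => //= c s IH sk.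
rewrite IH; last exact: ltnW.
have [cs /(_ sk) ds] := CK s (ltnW sk).
have [ccs _] := CK (c :: s) sk.
apply/funext => p.
have dc := is_derive_torus_conv bkap p (torus_fun_pderiv s pK) cs (ds c) ccs.
have dp : is_derive p (direction c) (pderiv s K) ('D_(direction c) (pderiv s K) p).
  exact: DeriveDef.
exact: (@derive_val _ _ _ _ _ _ _ (is_deriveB dc dp)).
Qed.

Lemma torus_fun_line_periodic G p c : torus_fun G ->
  periodic (fun s : R => G (p + s *: direction c)) 1.
Proof. by move=> pG s; rewrite /= scalerDl scale1r addrA pG. Qed.

Lemma continuous_line G p c : continuous G ->
  continuous (fun s : R => G (p + s *: direction c)).
Proof.
move=> cG s; apply: (@continuous_comp _ _ _ (fun s : R => p + s *: direction c) G); last exact: cG.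
by apply: cvgD; [exact: cvg_cst|apply: cvgZr_tmp; exact: cvg_id].
Qed.

(** Because the Fejer kernel is a probability density, a constant bound [a] on the
    oscillation of [G] is kept, while the part controlled by sin^2 is damped by
    [sin2_mul_fejer_le]. *)
Lemma fejer_axis_conv_error N G c p (a b : R) : bmfun G ->
  0 <= a -> 0 <= b ->
  (forall s, 0 <= s <= 1 ->
    `|G (p + s *: direction c) - G p| <= a + b * sin (pi * s) ^+ 2) ->
  `|axis_conv (fejer_kernel N) c G p - G p| <= a + b * N.+1%:R^-1.
Proof.
move=> bG a0 b0 Gab.
have bF := bmfun_fejer R N.
have bFG := bmfun_axis_conv_section c p bF bG.
have bFc (x : R) : bmfun ((fun s => fejer_kernel N s * x) : measurableTypeR R -> R).
  by apply: bmfunM => //; exact: bmfun_cst.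
have bdiff : bmfun ((fun s => fejer_kernel N s * (G (p + s *: direction c) - G p))
    : measurableTypeR R -> R).
  by under eq_fun do rewrite mulrBr; exact: bmfunB.
have -> : axis_conv (fejer_kernel N) c G p - G p =
    \int[lam]_s (fejer_kernel N s * (G (p + s *: direction c) - G p)).
  under [RHS]eq_Rintegral do rewrite mulrBr.
  by rewrite meanB// meanZr// mean_fejer mul1r.
rewrite (le_trans (le_norm_mean _ _))//.
have -> : a + b * N.+1%:R^-1 = \int[lam]_s (fejer_kernel N s * a + b * N.+1%:R^-1).
  by rewrite meanD//; [rewrite meanZr// mean_fejer mul1r mean_cst|exact: bmfun_cst].
apply: le_circle_mean; first exact: bmfun_norm.
  by apply: bmfunD => //; exact: bmfun_cst.
move=> s s01; rewrite normrM ger0_norm ?fejer_kernel_ge0//.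
rewrite (le_trans (ler_wpM2l (fejer_kernel_ge0 _ _) (Gab s s01)))//.
rewrite mulrDr lerD2l mulrCA ler_wpM2l// mulrC; exact: sin2_mul_fejer_le.
Qed.

Lemma fejer_axis_conv_cvg G c (e : R) : torus_fun G -> continuous G -> 0 < e ->
  exists2 b : R, 0 <= b & forall N p,
    `|axis_conv (fejer_kernel N) c G p - G p| <= e + b * N.+1%:R^-1.
Proof.
move=> pG cG e0; have bG := bmfun_torus_fun pG cG.
have [_ [M GM]] := bG.
have M0 : 0 <= M by rewrite (le_trans _ (GM 0)).
have [r r0 Gr] := torus_fun_unif_continuous c pG cG e0.
(* Away from the integers sin (pi s) >= r / 2, whereas G oscillates by at
   most 2 M. *)
exists (2 * M * (4 / r ^+ 2)).
  by rewrite !mulr_ge0// ?invr_ge0 ?exprn_ge0 ?ltW.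
move=> N p; apply: fejer_axis_conv_error => //; first exact: ltW.
  by rewrite !mulr_ge0// ?invr_ge0 ?exprn_ge0 ?ltW.
move=> s s01.
have B0 : 0 <= 2 * M * (4 / r ^+ 2) * sin (pi * s) ^+ 2.
  by rewrite mulr_ge0 ?sqr_ge0// !mulr_ge0// ?invr_ge0 ?exprn_ge0 ?ltW.
have [sr|rs] := ltP s r.
  rewrite -[leLHS]addr0 lerD//; apply/ltW/Gr.
  by rewrite ger0_norm//; case/andP: s01.
have [sr|rs'] := ltP (1 - s) r.
  rewrite -[leLHS]addr0 lerD//.
  have := torus_fun_line_periodic p c pG (s - 1); rewrite /= subrK => ->.
  apply/ltW/Gr; rewrite distrC ger0_norm// subr_ge0; by case/andP: s01.
have rsin : r / 2 <= sin (pi * s).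
  by apply: le_trans (sin_pi_ge_min s01); rewrite ler_pM2r// le_min rs.
rewrite -[leLHS]add0r; apply: lerD; first exact: ltW.
rewrite (le_trans (ler_normB _ _))// (le_trans (lerD (GM _) (GM _)))//.
rewrite (_ : M + M = 2 * M * 1); last by rewrite mulr1 mulrDl !mul1r.
rewrite -[leRHS]mulrA ler_wpM2l ?mulr_ge0//.
rewrite [leLHS](_ : _ = 4 / r ^+ 2 * (r / 2) ^+ 2); last by field; rewrite gt_eqF.
have r20 : 0 <= r / 2 by rewrite divr_ge0// ltW.
rewrite ler_wpM2l//; first by rewrite divr_ge0// exprn_ge0// ltW.
by rewrite lerXn2r ?nnegrE// (le_trans r20).
Qed.

Section differentiable.
Variables (G : point -> R) (c : 'I_d + 'I_d) (M : R).
Hypotheses (pG : torus_fun G) (cG : continuous G).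
Hypothesis dG : forall q, derivable G q (direction c).
Hypothesis cdG : continuous (fun q => 'D_(direction c) G q).
Hypothesis dGM : forall q, `|'D_(direction c) G q| <= M.

Let M0 : 0 <= M. Proof. exact: le_trans (dGM 0). Qed.

Lemma lipschitz_line p (s : R) : 0 <= s -> `|G (p + s *: direction c) - G p| <= M * s.
Proof.
move=> s0.
have [x _ xE] := @MVT_segment _ (fun s : R => G (p + s *: direction c))
  (fun s => 'D_(direction c) G (p + s *: direction c)) 0 s s0
  (fun x _ => is_derive_line (@dG _)) (continuous_subspaceT (@continuous_line G p c cG)).
move: xE; rewrite scale0r addr0 subr0 => ->.
by rewrite normrM (ger0_norm s0) ler_wpM2r.
Qed.

(** By periodicity an increment [s] may be replaced by [1 - s], so the oscillation
    is bounded by the distance to the integers and not just by [s]. *)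
Lemma lipschitz_line_sin p (s : R) : 0 <= s <= 1 ->
  `|G (p + s *: direction c) - G p| <= M * (2 * sin (pi * s)).
Proof.
move=> s01; have /andP[s0 s1] := s01.
apply: (@le_trans _ _ (M * Num.min s (1 - s))); last first.
  by rewrite ler_wpM2l// mulrC -ler_pdivrMr// sin_pi_ge_min.
have [_|_] := leP s (1 - s); first exact: lipschitz_line.
have := lipschitz_line (p + s *: direction c) (s := 1 - s).
rewrite -addrA -scalerDl subrKC scale1r pG distrC; apply.
by rewrite subr_ge0.
Qed.

Lemma fejer_axis_conv_rate N p :
  `|axis_conv (fejer_kernel N) c G p - G p| <= 4 * M * 2 ^- log4 N.
Proof.
have bG := bmfun_torus_fun pG cG.
(* The oscillation is linear in x = sin (pi s), and 2 x <= h + x^2 / h; this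
   h balances the two terms since 4 ^ log4 N <= N + 1. *)
pose h : R := 2 ^- log4 N.
have h0 : 0 < h by rewrite invr_gt0 exprn_gt0.
rewrite (le_trans (fejer_axis_conv_error (a := 2 * M * h) (b := 2 * M * h^-1) _ _ _ _ _))//.
- by rewrite !mulr_ge0// ltW.
- by rewrite !mulr_ge0// invr_ge0 ltW.
- move=> s s01; rewrite (le_trans (lipschitz_line_sin p s01))//.
  rewrite -!mulrA -mulrDr -mulrDr mulrCA !ler_wpM2l//.
  set x := sin _; have : 0 <= (h - x) ^+ 2 / h by rewrite divr_ge0 ?sqr_ge0// ltW.
  have -> : (h - x) ^+ 2 / h = h + h^-1 * x ^+ 2 - 2 * x.
    by field; rewrite gt_eqF.
  have : 0 <= x by apply: le_trans (sin_pi_ge_min s01); case/andP: s01 => ? ?;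
    rewrite divr_ge0// le_min subr_ge0; apply/andP.
  by lra.
have : N.+1%:R^-1 <= h * h.
  rewrite /h -invfM lef_pV2 ?posrE ?mulr_gt0 ?exprn_gt0//.
  by rewrite -exprMn -!natrM -natrX ler_nat log4_lb.
have h2 : 0 <= 2 * M * h^-1 by rewrite !mulr_ge0// invr_ge0 ltW.
move=> /(ler_wpM2l h2); rewrite [leRHS]mulrA divfK ?gt_eqF// => hN.
rewrite (le_trans (lerD (lexx _) hN))// -/h; lra.
Qed.

(** As operators, D_N - I = (D_N - F_N) + (F_N - I). The first term is integrated
    by parts and costs the derivative of [G] times the L^1 norm of the conjugate kernel over
    N + 1; the second is [fejer_axis_conv_rate]. *)
Lemma dirichlet_axis_conv_rate N p : `|axis_conv (dirichlet_kernel N) c G p - G p| <=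
  5 * M * lebesgue_bound R N * 2 ^- log4 N.
Proof.
have bG := bmfun_torus_fun pG cG.
have bdG := bmfun_torus_fun (torus_fun_derive c pG) cdG.
have N0 : 0 < N.+1%:R^-1 :> R by rewrite invr_gt0.
have pi1 : 1 <= 2 * pi :> R by have := pi_ge2 R; lra.
have pi0 : 0 < 2 * pi :> R by exact: lt_le_trans pi1.
pose a : R := N.+1%:R^-1 / (2 * pi).
have a0 : 0 < a by rewrite divr_gt0.
have aN0 : a != 0 by rewrite gt_eqF.
pose H' (s : R) := 2 * pi * (2 * \sum_(k < N) (k.+1%:R * cos (k.+1%:R * (pi *+ 2 * s)))).
have E : axis_conv (dirichlet_kernel N) c G p - axis_conv (fejer_kernel N) c G p =
    - (a * axis_conv (conj_dirichlet_kernel N) c (fun q => 'D_(direction c) G q) p).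
  rewrite -meanB; [|by apply: bmfun_axis_conv_section => //; exact: bmfun_dirichlet
    |by apply: bmfun_axis_conv_section => //; exact: bmfun_fejer].
  have bHG : bmfun ((fun s => conj_dirichlet_kernel N s *
      'D_(direction c) G (p + s *: direction c)) : measurableTypeR R -> R).
    exact: (bmfun_axis_conv_section c p (bmfun_conj_dirichlet R N) bdG).
  have by_parts : \int[lam]_s (G (p + s *: direction c) * H' s) =
      - \int[lam]_s ('D_(direction c) G (p + s *: direction c) * conj_dirichlet_kernel N s).
    apply: circle_by_parts.
    - by move=> s; exact: is_derive_line (@dG _).
    - exact: (@continuous_line (fun q => 'D_(direction c) G q)).
    - by move=> s; exact: is_derive_conj_dirichlet.
    - move=> s; apply: cvgMr; apply: cvgMr; apply: continuous_sumr => k x.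
      by apply: cvgMr; exact: continuous_cos_freq.
    - by rewrite /conj_dirichlet_kernel big1 ?mulr0// => k _; rewrite !mulr0 sin0.
    - by rewrite /conj_dirichlet_kernel big1 ?mulr0// => k _; rewrite sin_freq_int.
  rewrite /axis_conv; under [in RHS]eq_Rintegral do rewrite mulrC.
  have DFE (s : R) : dirichlet_kernel N s * G (p + s *: direction c) -
      fejer_kernel N s * G (p + s *: direction c) =
      a * (G (p + s *: direction c) * H' s).
    have aE : N.+1%:R^-1 = a * (2 * pi) by rewrite /a divfK// gt_eqF.
    by rewrite -mulrBl dirichlet_fejer aE /H'; ring.
  rewrite -mulrN -by_parts -meanZl; first by apply: eq_Rintegral => s _; exact: DFE.
  have -> : (fun s => G (p + s *: direction c) * H' s) =
      fun s => a^-1 * (dirichlet_kernel N s * G (p + s *: direction c) -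
        fejer_kernel N s * G (p + s *: direction c)).
    by apply/funext => s; rewrite DFE mulKf.
  apply: bmfunM; first exact: bmfun_cst.
  by apply: bmfunB; apply: bmfun_axis_conv_section => //; [exact: bmfun_dirichlet|exact: bmfun_fejer].
rewrite -(subrKA (axis_conv (fejer_kernel N) c G p)) (le_trans (ler_normD _ _))//.
rewrite E normrN normrM (gtr0_norm a0).
have l1 := lebesgue_bound_ge1 R N.
have h1 := fejer_axis_conv_rate N p.
have h2 := axis_conv_le c (@bmfun_conj_dirichlet R N) bdG M0 (mean_norm_conj_dirichlet R N) dGM p.
have aN : a <= 2 ^- log4 N.
  rewrite (@le_trans _ _ N.+1%:R^-1)//.
    by rewrite /a ler_pdivrMr// ler_peMr// ltW.
  rewrite lef_pV2 ?posrE ?exprn_gt0// -natrX ler_nat (leq_trans _ (log4_lb N))//.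
  by case: (log4 N) => // m; rewrite leq_exp2r.
have p2 : 0 < 2 ^- log4 N :> R by rewrite invr_gt0 exprn_gt0.
have h3 := ler_pM (ltW a0) (normr_ge0 _) aN h2.
have h4 : M * 1 * 2 ^- log4 N <= M * lebesgue_bound R N * 2 ^- log4 N.
  by rewrite ler_pM2r// ler_wpM2l.
move: h1 h3 h4; move: (2 ^- log4 N) (lebesgue_bound R N) => h l; lra.
Qed.

End differentiable.
End approximation.

(** * Uniform convergence *)

Section limits.
Variable R : realType.

Lemma bernoulli_le (x : R) (m : nat) : 0 <= x -> 1 + m%:R * x <= (1 + x) ^+ m.
Proof.
move=> x0; elim: m => [|m IH]; first by rewrite mul0r addr0 expr0.
rewrite exprS (le_trans _ (ler_wpM2l _ IH))//; last by rewrite addr_ge0.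
have : 0 <= m%:R * x * x by rewrite !mulr_ge0.
by rewrite -natr1; lra.
Qed.

(** By induction on [j]: the ratio is split as sqrt q * sqrt q, one factor
    absorbing the power [j] and the other one the additional linear factor, by
    Bernoulli's inequality. *)
Lemma poly_le_geometric (j : nat) (q : R) : 1 < q ->
  exists2 A : R, 0 <= A & forall m, m.*2.+1%:R ^+ j <= A * q ^+ m.
Proof.
elim: j q => [|j IH] q q1.
  by exists 1 => // m; rewrite expr0 mul1r exprn_ege1// ltW.
have q0 : 0 < q by rewrite (lt_trans _ q1).
have s1 : 1 < Num.sqrt q by rewrite -sqrtr1 ltr_sqrt.
have [A A0 HA] := IH _ s1.
pose x := Num.sqrt q - 1.
have x0 : 0 < x by rewrite subr_gt0.
have [xE xK] : Num.sqrt q = 1 + x /\ 2 / x * x = 2.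
  by rewrite /x subrKC divfK// gt_eqF.
exists ((1 + 2 / x) * A).
  by rewrite mulr_ge0// addr_ge0// divr_ge0// ltW.
move=> m; rewrite exprS.
have -> : q ^+ m = Num.sqrt q ^+ m * Num.sqrt q ^+ m.
  by rewrite -exprMn -expr2 sqr_sqrtr// ltW.
rewrite mulrACA; apply: ler_pM => //.
rewrite xE (le_trans _ (ler_wpM2l _ (bernoulli_le m (ltW x0))))//; last first.
  by rewrite addr_ge0// divr_ge0// ltW.
rewrite -natr1 -mul2n natrM [leRHS]mulrDl mul1r.
have -> : 2 / x * (1 + m%:R * x) = 2 / x + 2 * m%:R 
  by rewrite mulrDr mulr1 [m%:R * x]mulrC mulrA xK.
have : 0 <= m%:R * x by rewrite mulr_ge0// ltW.
have : 0 <= 2 / x by rewrite divr_ge0// ltW.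
lra.
Qed.

Lemma poly_geometric_small (j : nat) (e : R) : 0 < e ->
  exists m0, forall m, (m0 <= m)%N -> m.*2.+1%:R ^+ j * 2 ^- m <= e.
Proof.
move=> e0; (* Any ratio strictly between 1 and 2 would do. *)
have [|A A0 HA] := @poly_le_geometric j (3 / 2); first by lra.
have : A * (3 / 4) ^+ m @[m --> \oo] --> (0 : R).
  rewrite -(mulr0 A); apply: cvgMr; apply: cvg_expr.
  by rewrite ger0_norm; lra.
move/cvgr0_norm_lt => /(_ _ e0)[m0 _ Hm0]; exists m0 => m /Hm0 /=.
move=> /ltW; apply: le_trans; rewrite (le_trans _ (ler_norm _))//.
have p2 : 0 < 2 ^+ m :> R by rewrite exprn_gt0.
rewrite ler_pdivrMr// -mulrA -exprMn (le_trans (HA m))//.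
by rewrite (_ : 3 / 4 * 2 = 3 / 2 :> R)//; lra.
Qed.

Lemma log4_cvg m0 : exists N0, forall N, (N0 <= N)%N -> (m0 <= log4 N)%N.
Proof.
exists (4 ^ m0)%N => N N0N; apply: trunc_log_max => //.
exact: leq_trans (leqnSn _).
Qed.

Variable d : nat.
Notation point := ('rV[R]_d * 'rV[R]_d)%type.
Notation lam := (@circle_measure R).
Implicit Types (p q : point) (c : 'I_d + 'I_d) (G K : point -> R).

Definition axis c : 'I_d := match c with inl i => i | inr i => i end.

Definition axis_kernel (k : nat -> R -> R) (r : {ffun 'I_d -> nat}) c : R -> R :=
  k (r (axis c)).

Lemma fejer_conv_cvg G (e : R) : torus_fun G -> continuous G -> 0 < e ->
  exists N0, forall r : {ffun 'I_d -> nat}, (forall j, (N0 <= r j)%N) ->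
    forall p, `|torus_conv (axis_kernel (@fejer_kernel R) r) G p - G p| <= e.
Proof.
move=> pG cG e0; have bG := bmfun_torus_fun pG cG.
pose e1 := e / (d + d).+1%:R.
have e10 : 0 < e1 by rewrite divr_gt0.
have /choice[b bP] c : exists b : R, 0 <= b /\ forall N p,
    `|axis_conv (fejer_kernel N) c G p - G p| <= e1 + b * N.+1%:R^-1.
  by have [b b0 bP] := fejer_axis_conv_cvg c pG cG e10; exists b.
(* The errors e1 + b c / (N0 + 1) sum up to at most (d + d) e1 + e1. *)
pose B := \sum_c b c.
have B0 : 0 <= B by apply: sumr_ge0 => c _; case: (bP c).
have [N0 HN0] : exists N0 : nat, B * N0.+1%:R^-1 <= e1.
  exists (Num.bound (B / e1)); rewrite ler_pdivrMr// mulrC -ler_pdivrMr//.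
  have /ltW h := archi_boundP (divr_ge0 B0 (ltW e10)).
  by rewrite (le_trans h)// ler_nat.
exists N0 => r rN0 p.
rewrite (le_trans (@torus_conv_error _ _ (axis_kernel (@fejer_kernel R) r) _ G (fun=> 1)
  (fun c => e1 + b c * N0.+1%:R^-1) _ _ _ _ p))//.
- by move=> c; exact: bmfun_fejer.
- move=> c; rewrite le_eqVlt; apply/orP; left; apply/eqP.
  under eq_Rintegral do rewrite ger0_norm ?fejer_kernel_ge0//.
  exact: mean_fejer.
- move=> c q; have [b0 /(_ (r (axis c)) q) h] := bP c.
  rewrite (le_trans h)// lerD2l ler_wpM2l// lef_pV2 ?posrE// ler_nat ltnS.
  exact: rN0.
under eq_bigr do rewrite expr1n mul1r.
rewrite big_split/= sumr_const card_sum !card_ord -mulr_suml -/B.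
have eE : e = e1 *+ (d + d).+1 by rewrite -[RHS]mulr_natr divfK// pnatr_eq0.
by rewrite [leRHS]eE [leRHS]mulrSr lerD2l.
Qed.

Lemma dirichlet_conv_cvg G (e : R) : torus_fun G -> continuous G ->
  (forall c q, derivable G q (direction c)) ->
  (forall c, continuous (fun q => 'D_(direction c) G q)) -> 0 < e ->
  exists N0, forall r : {ffun 'I_d -> nat}, (forall j, (N0 <= r j)%N) ->
    forall p, `|torus_conv (axis_kernel (@dirichlet_kernel R) r) G p - G p| <= e.
Proof.
move=> pG cG dG cdG e0; have bG := bmfun_torus_fun pG cG.
have /choice[b bP] c : exists b : R, forall q, `|'D_(direction c) G q| <= b.
  by have [_ ] := bmfun_torus_fun (torus_fun_derive c pG) (cdG c).
pose M := \sum_c `|b c|.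
have M0 : 0 <= M by apply: sumr_ge0.
have dGM c q : `|'D_(direction c) G q| <= M.
  rewrite (le_trans (bP c q))// (le_trans (ler_norm _))// /M (bigD1 c)//= lerDl.
  exact: sumr_ge0.
pose n := (d + d)%N.
pose C := n%:R * (5 * M * 16 ^+ n.+1).
have C0 : 0 <= C by rewrite !mulr_ge0// exprn_ge0.
have e1 : 0 < e / (C + 1) by rewrite divr_gt0// ltr_wpDl.
have [m0 Hm0] := poly_geometric_small n.+1 e1.
have [N0 HN0] := log4_cvg m0.
exists N0 => r rN0 p.
rewrite (le_trans (@torus_conv_error _ _ (axis_kernel (@dirichlet_kernel R) r) _ G
  (fun c => lebesgue_bound R (r (axis c)))
  (fun c => 5 * M * lebesgue_bound R (r (axis c)) * 2 ^- log4 (r (axis c))) _ _ _ _ p))//.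
- by move=> c; exact: bmfun_dirichlet.
- by move=> c; exact: lebesgue_bound_ge1.
- by move=> c; exact: mean_norm_dirichlet.
- by move=> c q; exact: dirichlet_axis_conv_rate.
rewrite (@le_trans _ _ (\sum_(c : 'I_d + 'I_d) 5 * M * 16 ^+ n.+1 * (e / (C + 1))))//.
  apply: ler_sum => c _.
  have := Hm0 _ (HN0 _ (rN0 (axis c))); set m := log4 _ => h.
  have -> : lebesgue_bound R (r (axis c)) ^+ (d + d) *
      (5 * M * lebesgue_bound R (r (axis c)) * 2 ^- m) =
      5 * M * 16 ^+ n.+1 * (m.*2.+1%:R ^+ n.+1 * 2 ^- m).
    by rewrite /lebesgue_bound -/m -/n !exprS exprMn; ring.
  by rewrite ler_wpM2l// mulr_ge0 ?exprn_ge0// mulr_ge0.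
rewrite sumr_const card_sum !card_ord -[leLHS]mulr_natl -/n.
set v := (C + 1)^-1.
have -> : n%:R * (5 * M * 16 ^+ n.+1 * (e * v)) = e * (C * v) by rewrite /C; ring.
rewrite /v ger_pMr//.
by rewrite ler_pdivrMr ?ltr_wpDl// mul1r lerDl.
Qed.

(** Only finitely many derivatives enter the norm, so the thresholds given for each
    of them have a common upper bound. *)
Lemma Ck_norm_cvg0 (kap : {ffun 'I_d -> nat} -> 'I_d + 'I_d -> R -> R) K :
  (forall r c, bmfun (kap r c : measurableTypeR R -> R)) -> torus_fun K -> Ck 2 K ->
  (forall s, (size s <= 2)%N -> forall e : R, 0 < e ->
    exists N0, forall r : {ffun 'I_d -> nat}, (forall j, (N0 <= r j)%N) ->
    forall p, `|torus_conv (kap r) (pderiv s K) p - pderiv s K p| <= e) ->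
  (fun r => Ck_norm 2 (torus_conv (kap r) K \- K)) @ min_infty d --> 0%E.
Proof.
move=> bkap pK CK H.
pose D r : point -> R := torus_conv (kap r) K \- K.
have norm_ge0 r : (0 <= Ck_norm 2 (D r))%E.
  apply: le_trans (_ : (`|pderiv [::] (D r) 0|)%:E <= _)%E.
    by rewrite lee_fin.
  by apply: ereal_sup_ubound; exists [::] => //; exists 0.
have norm_le (e : R) : 0 < e ->
    \forall r \near min_infty d, (Ck_norm 2 (D r) <= e%:E)%E.
  move=> e0.
  have /choice[f fP] s : exists N0, (size s <= 2)%N -> forall r : {ffun 'I_d -> nat},
      (forall j, (N0 <= r j)%N) ->
      forall p, `|torus_conv (kap r) (pderiv s K) p - pderiv s K p| <= e.
    have [s2|_] := leqP (size s) 2; last by exists 0%N.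
    by have [N0 HN0] := H s s2 e e0; exists N0.
  pose N := maxn (f [::]) (maxn (\max_c f [:: c]) (\max_c \max_c' f [:: c; c'])).
  exists N => //= r rN; apply: ge_ereal_sup => _ [s /= s2 [p _ <-]].
  rewrite lee_fin /D (pderiv_torus_conv_sub (bkap r) pK CK s2); apply: (fP s s2) => j.
  apply: leq_trans (rN j); rewrite /N.
  case: s s2 => [|c [|c' []]]//= _.
  - by rewrite leq_maxl.
  - by rewrite !leq_max (leq_bigmax c) orbT.
  - rewrite !leq_max; apply/orP; right; apply/orP; right.
    apply: leq_trans (leq_bigmax c).
    exact: (leq_bigmax (F := fun c' => f [:: c; c']) c').
apply/fine_cvgP; split.
  apply: filterS (norm_le 1 ltr01) => r le1.
  by rewrite ge0_fin_numE; [exact: le_lt_trans le1 (ltry _)|exact: norm_ge0].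
apply/cvgr0Pnorm_le => e e0; apply: filterS (norm_le e e0) => r le1 /=.
have fin : Ck_norm 2 (D r) \is a fin_num.
  by rewrite ge0_fin_numE; [exact: le_lt_trans le1 (ltry _)|exact: norm_ge0].
rewrite ger0_norm; last by apply: fine_ge0; exact: norm_ge0.
by rewrite -lee_fin fineK.
Qed.

End limits.

(** * Translation invariance *)

Section torus_translation.
Variables (R : realType) (d : nat).
Notation point := ('rV[R]_d * 'rV[R]_d)%type.
Notation lam := (@circle_measure R).
Notation mu2 := (@torus2_measure R d).
Implicit Types (p q : point) (c : 'I_d + 'I_d) (G H : point -> R).

Lemma continuous_translate G p : continuous G -> continuous (fun q => G (q + p)).
Proof.
move=> cG q; apply: (@continuous_comp _ _ _ (fun q => q + p) G); last exact: cG.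
by apply: cvgD; [exact: cvg_id|exact: cvg_cst].
Qed.

Lemma torus_fun_translate G p : torus_fun G -> torus_fun (fun q => G (q + p)).
Proof. by move=> pG c q; rewrite addrAC pG. Qed.

Lemma torus2_shift_axis G c (a : R) : torus_fun G -> continuous G ->
  \int[mu2]_q G (q + a *: direction c) = \int[mu2]_q G q.
Proof.
move=> pG cG; have bG := bmfun_torus_fun pG cG.
have bGa := bmfun_torus_fun (torus_fun_translate (a *: direction c) pG)
  (@continuous_translate G (a *: direction c) cG).
rewrite (torus2_resample c bGa) [RHS](torus2_resample c bG).
apply: eq_Rintegral => q _.
pose q0 := set_pcoord c q 0.
have lineE s : set_pcoord c q s = q0 + s *: direction c.
  by rewrite /q0 /set_pcoord sub0r -addrA -scalerDl [- _ + s]addrC.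
under [RHS]eq_Rintegral do rewrite lineE.
rewrite -(@circle_shift _ (fun s => G (q0 + s *: direction c)) a).
- by apply: eq_Rintegral => s _; rewrite lineE scalerDl addrA.
- exact: continuous_line.
- exact: torus_fun_line_periodic.
Qed.

Lemma torus2_shift G p : torus_fun G -> continuous G ->
  \int[mu2]_q G (q + p) = \int[mu2]_q G q.
Proof.
move=> pG cG; rewrite (point_sum_direction p).
elim/big_rec : _ => [|c p' _ IH]; first by under eq_Rintegral do rewrite addr0.
under eq_Rintegral do rewrite addrA.
rewrite (@torus2_shift_axis (fun q => G (q + p')))//; first exact: torus_fun_translate.
exact: continuous_translate.
Qed.

(** The change of variables t = q - p; this is where periodicity of [G] and of the
    kernels is used. *)
Lemma torus_conv_kernel (kap : 'I_d + 'I_d -> R -> R) G p :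
  (forall c, continuous (kap c)) -> (forall c, periodic (kap c) 1) ->
  (forall c x, kap c (- x) = kap c x) -> torus_fun G -> continuous G ->
  torus_conv kap G p = \int[mu2]_q (G q * prod_kernel kap (p - q)).
Proof.
move=> ck pk ek pG cG.
pose h q := G q * prod_kernel kap (p - q).
have hE q : prod_kernel kap q * G (p + q) = h (q + p).
  rewrite /h [q + p]addrC opprD addNKr mulrC; congr (_ * _).
  by apply: eq_bigr => c _; rewrite pcoordN ek.
transitivity (\int[mu2]_q h (q + p)); first by apply: eq_Rintegral => q _; exact: hE.
apply: torus2_shift.
- move=> c q; rewrite /h pG; congr (_ * _); apply: eq_bigr => c' _.
  rewrite !pcoordB pcoordD pcoord_direction opprD addrA.
  case: (c' == c); last by rewrite subr0.
  by rewrite -[in RHS](subrK 1 (pcoord c' p - _)) pk.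
- move=> q; apply: cvgM; first exact: cG.
  have cont_k c : continuous (fun q : point => kap c (pcoord c (p - q))).
    move=> x; apply: (@continuous_comp _ _ _ (fun q => pcoord c (p - q)) (kap c)); last exact: ck.
    apply: (@continuous_comp _ _ _ (fun q => p - q) (pcoord c)); last exact: continuous_pcoord.
    by apply: cvgB; [exact: cvg_cst|exact: cvg_id].
  have : continuous (fun q => prod_kernel kap (p - q)); last exact.
  by apply: (@continuous_big R _ *%R 1 xpredT (@mul_continuous R)) => c _; exact: cont_k.
Qed.

End torus_translation.

(** * Fourier sums as integral operators *)

Section fsum_prod.
Variables (C : comNzRingType) (I : choiceType) (n : nat).

(** Distributes a product over sums in which the range of each index depends on the
    coordinate. The sequences are embedded in one finite type, where this is
    known. *)
Lemma fsum_prod (s : 'I_n -> seq I) (u : 'I_n -> I -> C) : (forall j, uniq (s j)) ->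
  \sum_(a \in [set a : {ffun 'I_n -> I} | forall j, a j \in s j]) \prod_j u j (a j) =
  \prod_j \sum_(k <- s j) u j k.
Proof.
move=> us; pose S := flatten [seq s j | j : 'I_n].
have sS j k : k \in s j -> k \in S.
  by move=> ks; apply/flattenP; exists (s j) => //; apply/mapP; exists j; rewrite ?mem_enum.
pose T := seq_sub S.
pose Q j := [pred x : T | val x \in s j].
pose h (g : {ffun 'I_n -> T}) : {ffun 'I_n -> I} := [ffun j => val (g j)].
have h_inj : injective h.
  move=> g g' /ffunP gg'; apply/ffunP => j; apply: val_inj.
  by have := gg' j; rewrite !ffunE.
have sumE j : \sum_(k <- s j) u j k = \sum_(x in Q j) u j (val x).
  rewrite -[RHS](big_map val (fun k => k \in s j) (u j)) -big_filter.
  apply: perm_big; apply: uniq_perm => //.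
    by rewrite filter_uniq// map_inj_uniq ?index_enum_uniq//; exact: val_inj.
  move=> k; rewrite mem_filter; apply/idP/andP => [ks|[]//].
  by split=> //; apply/mapP; exists (SeqSub (sS _ _ ks)).
under [RHS]eq_bigr do rewrite sumE.
rewrite bigA_distr_big_dep /=.
have -> : [set a : {ffun 'I_n -> I} | forall j, a j \in s j] =
    [set` [seq h g | g <- enum (family Q)]].
  apply/seteqP; split => [a aP|_ /mapP[g + ->] j] /=.
    apply/mapP; exists [ffun j => SeqSub (sS _ _ (aP j))].
      by rewrite mem_enum; apply/familyP => j; rewrite inE ffunE /=; exact: aP.
    by apply/ffunP => j; rewrite !ffunE.
  by rewrite mem_enum => /familyP/(_ j); rewrite inE ffunE.
rewrite -fsbig_seq ?map_inj_uniq ?enum_uniq//= big_map big_enum /=.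
by apply: eq_bigr => g _; apply: eq_bigr => j _; rewrite ffunE.
Qed.

End fsum_prod.

Section fourier_kernel.
Variables (R : realType) (d : nat).
Notation point := ('rV[R]_d * 'rV[R]_d)%type.
Notation mu2 := (@torus2_measure R d).
Implicit Types (p q : point) (K : point -> R).

Lemma expiD (s t : R) : expi (s + t) = expi s * expi t.
Proof.
rewrite /expi cosD sinD; apply/eqP; rewrite eq_complex /=.
by apply/andP; split; apply/eqP; ring.
Qed.

Lemma expi0 : expi 0 = 1 :> R[i]%C.
Proof. by rewrite /expi cos0 sin0. Qed.

Lemma expi_sum (I : Type) (s : seq I) (F : I -> R) :
  expi (\sum_(i <- s) F i) = \prod_(i <- s) expi (F i).
Proof. by apply: (big_morph _ expiD expi0). Qed.

Fixpoint zseq (N : nat) : seq int :=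
  if N is M.+1 then Posz M.+1 :: Negz M :: zseq M else [:: 0].

Lemma mem_zseq N k : (k \in zseq N) = (`|k| <= N)%N.
Proof.
elim: N => [|N IH]; first by rewrite inE leqn0 absz_eq0.
by rewrite !inE IH; lia.
Qed.

Lemma zseq_uniq N : uniq (zseq N).
Proof. by elim: N => //= N IH; rewrite !inE !mem_zseq IH; lia. Qed.

Lemma zboxE (r : {ffun 'I_d -> nat}) :
  zbox r = [set a : {ffun 'I_d -> int} | forall j, a j \in zseq (r j)].
Proof. by apply/seteqP; split => a h j; have := h j; rewrite mem_zseq. Qed.

Lemma nboxE (r : {ffun 'I_d -> nat}) :
  nbox r = [set a : {ffun 'I_d -> nat} | forall j, a j \in index_iota 0 (r j).+1].
Proof. by apply/seteqP; split => a h j; have := h j; rewrite mem_index_iota. Qed.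

(** Opposite frequencies are consecutive in [zseq], so that each step of the
    induction adds 2 cos. *)
Lemma sum_expi_zseq N (t : R) :
  \sum_(k <- zseq N) expi (pi *+ 2 * (k%:~R * t)) = (dirichlet_kernel N t)%:C%C.
Proof.
elim: N => [|N IH].
  by rewrite /= big_seq1 mul0r mulr0 expi0 /dirichlet_kernel big_ord0 mulr0 addr0.
rewrite /= !big_cons IH NegzE mulrNz mulNr mulrN expiN dirichlet_kernelS /expi.
rewrite (_ : N.+1%:~R = N.+1%:R)// mulrCA.
by apply/eqP; rewrite eq_complex /=; apply/andP; split; apply/eqP; ring.
Qed.

Definition tensor_kernel (k : nat -> R -> R) (r : {ffun 'I_d -> nat}) (x : 'rV[R]_d) : R :=
  \prod_j k (r j) (x ord0 j).

Lemma sum_expi_zbox (r : {ffun 'I_d -> nat}) (x : 'rV[R]_d) :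
  \sum_(a \in zbox r) expi (pi *+ 2 * dotz a x) =
  (tensor_kernel (@dirichlet_kernel R) r x)%:C%C.
Proof.
rewrite zboxE /tensor_kernel rmorph_prod /=.
under [RHS]eq_bigr do rewrite -sum_expi_zseq.
rewrite -fsum_prod; last by move=> j; exact: zseq_uniq.
by apply: eq_fsbigr => a _; rewrite /dotz mulr_sumr expi_sum.
Qed.

Lemma sum_nbox (k : nat -> R -> R) (r : {ffun 'I_d -> nat}) (x : 'rV[R]_d) :
  \sum_(s \in nbox r) tensor_kernel k s x =
  \prod_j \sum_(s < (r j).+1) k s (x ord0 j).
Proof.
rewrite nboxE (fsum_prod (fun j s => k s (x ord0 j))); last by move=> j; exact: iota_uniq.
by apply: eq_bigr => j _; rewrite big_mkord.
Qed.

Lemma Re_fsum (I : choiceType) (A : set I) (f : I -> R[i]%C) : finite_set A ->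
  complex.Re (\sum_(a \in A) f a) = \sum_(a \in A) complex.Re (f a).
Proof.
move=> fA; rewrite !fsbig_finite//.
by apply: (big_morph (@complex.Re R)) => // [[a b] [a' b']].
Qed.

Lemma phaseB (a b : {ffun 'I_d -> int}) p q : phase a b (p - q) = phase a b p - phase a b q.
Proof.
rewrite /phase -mulrBr; congr (_ * _).
have dB e x y : dotz e (x - y : 'rV[R]_d) = dotz e x - dotz e y.
  by rewrite /dotz -sumrB; apply: eq_bigr => j _; rewrite !mxE mulrBr.
by rewrite /= !dB; ring.
Qed.

Lemma sum_cos_phase (r1 r2 : {ffun 'I_d -> nat}) p :
  \sum_(a \in zbox r1) \sum_(b \in zbox r2) cos (phase a b p) =
  tensor_kernel (@dirichlet_kernel R) r1 p.1 * tensor_kernel (@dirichlet_kernel R) r2 p.2.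
Proof.
transitivity (complex.Re (\sum_(a \in zbox r1) \sum_(b \in zbox r2) expi (phase a b p))).
  rewrite Re_fsum; last exact: finite_zbox.
  by apply: eq_fsbigr => a _; rewrite Re_fsum//; exact: finite_zbox.
have -> : \sum_(a \in zbox r1) \sum_(b \in zbox r2) expi (phase a b p) =
   (\sum_(a \in zbox r1) expi (pi *+ 2 * dotz a p.1)) *
   (\sum_(b \in zbox r2) expi (pi *+ 2 * dotz b p.2)).
  rewrite mulr_fsuml; apply: eq_fsbigr => a _.
  rewrite mulr_fsumr; apply: eq_fsbigr => b _.
  by rewrite /phase mulrDr expiD.
by rewrite !sum_expi_zbox; simpc.
Qed.

Lemma measurable_phase (a b : {ffun 'I_d -> int}) : measurable_fun setT (@phase R d a b).
Proof.
have md (e : {ffun 'I_d -> int}) : measurable_fun setT (@dotz R d e).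
  apply: measurable_sum => j; apply: measurable_funM; first exact: measurable_cst.
  exact: measurable_coord.
apply: measurable_funM; first exact: measurable_cst.
apply: measurable_funD; [exact: measurableT_comp (md a) measurable_fst|].
exact: measurableT_comp (md b) measurable_snd.
Qed.

Lemma bmfun_cos_phase (a b : {ffun 'I_d -> int}) p : bmfun (fun q => cos (phase a b (p - q))).
Proof.
split; last by exists 1 => q; exact: cos_max.
apply: measurableT_comp; first exact: continuous_measurable_fun (@continuous_cos R).
under eq_fun do rewrite phaseB.
apply: measurable_funB; first exact: measurable_cst.
exact: measurable_phase.
Qed.

Lemma mean_fsum d' (T : measurableType d') (P : probability T R) (I : choiceType)
    (A : set I) (F : I -> T -> R) : finite_set A -> (forall i, bmfun (F i)) ->
  \int[P]_x (\sum_(i \in A) F i x) = \sum_(i \in A) \int[P]_x F i x.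
Proof.
move=> fA bF; rewrite fsbig_finite// -mean_sum//.
by apply: eq_Rintegral => x _; rewrite fsbig_finite.
Qed.

Lemma bmfun_fsum d' (T : measurableType d') (I : choiceType)
    (A : set I) (F : I -> T -> R) : finite_set A -> (forall i, bmfun (F i)) ->
  bmfun (fun x => \sum_(i \in A) F i x).
Proof.
by move=> fA bF; under eq_fun do rewrite fsbig_finite//; exact: bmfun_sum.
Qed.

Lemma Re_fourier_term K (a b : {ffun 'I_d -> int}) p : bmfun K ->
  complex.Re (fourier_coef K a b * expi (phase a b p)) =
  \int[mu2]_q (K q * cos (phase a b (p - q))).
Proof.
move=> bK; rewrite /fourier_coef /Cintegral /expi; simpc => /=.
set I1 := Rintegral _ _ _; set I2 := Rintegral _ _ _.
have bs (f : R -> R) : continuous f -> (forall x, `|f x| <= 1) ->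
    bmfun (fun q => f (- phase a b q)).
  move=> cf f1; split; last by exists 1 => q.
  apply: measurableT_comp; first exact: continuous_measurable_fun cf.
  by apply: measurable_funN; exact: measurable_phase.
have bc := bs _ (@continuous_cos R) (@cos_max R).
have bsi := bs _ (@continuous_sin R) (@sin_max R).
have -> : I1 = \int[mu2]_q (K q * cos (- phase a b q)).
  by apply: eq_Rintegral => q _; rewrite /=; ring.
have -> : I2 = \int[mu2]_q (K q * sin (- phase a b q)).
  by apply: eq_Rintegral => q _; rewrite /=; ring.
rewrite -!meanZr; try exact: bmfunM.
rewrite -meanB; try by apply: bmfunM; [exact: bmfunM|exact: bmfun_cst].
by apply: eq_Rintegral => q _; rewrite phaseB addrC cosD; ring.
Qed.

Lemma fourier_sum_kernel K (r1 r2 : {ffun 'I_d -> nat}) p : bmfun K ->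
  fourier_sum K r1 r2 p = \int[mu2]_q (K q *
    (tensor_kernel (@dirichlet_kernel R) r1 (p - q).1 * tensor_kernel (@dirichlet_kernel R) r2 (p - q).2)).
Proof.
move=> bK; rewrite /fourier_sum /fourier_sumC Re_fsum; last exact: finite_zbox.
under [RHS]eq_Rintegral do rewrite -sum_cos_phase mulr_fsumr.
have bt a b : bmfun (fun q => K q * cos (phase a b (p - q))).
  by apply: bmfunM => //; exact: bmfun_cos_phase.
rewrite mean_fsum; [|exact: finite_zbox|].
  apply: eq_fsbigr => a _; rewrite Re_fsum; last exact: finite_zbox.
  under [RHS]eq_Rintegral do rewrite mulr_fsumr.
  rewrite mean_fsum; [|exact: finite_zbox|by []].
  by apply: eq_fsbigr => b _; rewrite Re_fourier_term.
move=> a; apply: bmfunM => //; apply: bmfun_fsum; first exact: finite_zbox.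
by move=> b; exact: bmfun_cos_phase.
Qed.

Lemma bmfun_tensor_kernel (k : nat -> R -> R) (r : {ffun 'I_d -> nat}) :
  (forall N, bmfun (k N : measurableTypeR R -> R)) -> bmfun (tensor_kernel k r).
Proof.
move=> bk; apply: bmfun_prod => j; apply: (bmfun_comp (bk (r j))).
exact: measurable_coord.
Qed.

Lemma measurable_pointB p : measurable_fun setT (fun q : point => p - q).
Proof.
apply: measurable_fun_point => c; under eq_fun do rewrite pcoordB.
by apply: measurable_funB; [exact: measurable_cst|exact: measurable_pcoord].
Qed.

Lemma bmfun_tensor_kernel2 (k : nat -> R -> R) (r1 r2 : {ffun 'I_d -> nat}) p :
  (forall N, bmfun (k N : measurableTypeR R -> R)) ->
  bmfun (fun q => tensor_kernel k r1 (p - q).1 * tensor_kernel k r2 (p - q).2).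
Proof.
move=> bk; apply: bmfunM.
- apply: (bmfun_comp (h := fun q => (p - q).1) (bmfun_tensor_kernel r1 bk)).
  exact: measurableT_comp measurable_fst (measurable_pointB p).
- apply: (bmfun_comp (h := fun q => (p - q).2) (bmfun_tensor_kernel r2 bk)).
  exact: measurableT_comp measurable_snd (measurable_pointB p).
Qed.

(** Averaging over the box of all [s <= r] factors into independent averages over
    each coordinate, which define the Fejer kernels. *)
Lemma tensor_kernel_fejer (r : {ffun 'I_d -> nat}) (x : 'rV[R]_d) :
  tensor_kernel (@fejer_kernel R) r x =
  (\prod_j (1 + r j)%N%:R^-1) * \sum_(s \in nbox r) tensor_kernel (@dirichlet_kernel R) s x.
Proof. by rewrite sum_nbox -big_split. Qed.

Lemma fejer_kernel_integral K (r1 r2 : {ffun 'I_d -> nat}) p : bmfun K ->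
  fejer K r1 r2 p = \int[mu2]_q (K q *
    (tensor_kernel (@fejer_kernel R) r1 (p - q).1 * tensor_kernel (@fejer_kernel R) r2 (p - q).2)).
Proof.
move=> bK; rewrite /fejer /fejerC.
have -> : (\prod_j ((1 + r1 j) * (1 + r2 j))%N%:R)^-1 =
    ((\prod_j (1 + r1 j)%N%:R^-1) * (\prod_j (1 + r2 j)%N%:R^-1))%:C%C :> R[i]%C.
  rewrite -prodfV -big_split rmorph_prod/=; apply: eq_bigr => j _.
  by rewrite natrM invfM rmorphM /= !fmorphV !rmorph_nat.
set c1 := \prod_j _; set c2 := \prod_j (1 + r2 j)%N%:R^-1.
have ReZ (c : R) (w : R[i]%C) : complex.Re (c%:C%C * w) = c * complex.Re w.
  by case: w => u v; simpc.
rewrite ReZ Re_fsum; last exact: finite_nbox.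
have bk := bmfun_dirichlet R.
have bt s1 s2 : bmfun (fun q => K q * (tensor_kernel (@dirichlet_kernel R) s1 (p - q).1 *
    tensor_kernel (@dirichlet_kernel R) s2 (p - q).2)).
  by apply: bmfunM => //; exact: bmfun_tensor_kernel2.
have bt1 s1 : bmfun (fun q => \sum_(s2 \in nbox r2)
    (K q * (tensor_kernel (@dirichlet_kernel R) s1 (p - q).1 *
    tensor_kernel (@dirichlet_kernel R) s2 (p - q).2))).
  by apply: bmfun_fsum; [exact: finite_nbox|move=> s2; exact: bt].
transitivity (c1 * c2 * \int[mu2]_q \sum_(s1 \in nbox r1) \sum_(s2 \in nbox r2)
    (K q * (tensor_kernel (@dirichlet_kernel R) s1 (p - q).1 *
    tensor_kernel (@dirichlet_kernel R) s2 (p - q).2))).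
  congr (_ * _); rewrite mean_fsum; [|exact: finite_nbox|exact: bt1].
  apply: eq_fsbigr => s1 _; rewrite Re_fsum; last exact: finite_nbox.
  rewrite mean_fsum; [|exact: finite_nbox|by move=> s2; exact: bt].
  by apply: eq_fsbigr => s2 _; rewrite -fourier_sum_kernel.
rewrite -meanZl; last by apply: bmfun_fsum; [exact: finite_nbox|exact: bt1].
apply: eq_Rintegral => q _; rewrite !tensor_kernel_fejer -/c1 -/c2.
rewrite mulrACA mulr_fsuml !mulr_fsumr; apply: eq_fsbigr => s1 _.
rewrite !mulr_fsumr; apply: eq_fsbigr => s2 _; ring.
Qed.

Lemma prod_kernel_axis (k : nat -> R -> R) (r : {ffun 'I_d -> nat}) p :
  prod_kernel (axis_kernel k r) p = tensor_kernel k r p.1 * tensor_kernel k r p.2.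
Proof. by rewrite /prod_kernel big_sumType. Qed.

End fourier_kernel.

(** * Positive semi-definiteness *)

Section positive_semidefinite.
Variables (R : realType) (d : nat).
Notation point := ('rV[R]_d * 'rV[R]_d)%type.
Notation mu := (@torus_measure R d).
Notation mu2 := (@torus2_measure R d).
Implicit Types (p q : point) (K : point -> R).

Lemma tensor_integral (a b : 'rV[R]_d -> R) :
  mu.-integrable setT (EFin \o a) -> mu.-integrable setT (EFin \o b) ->
  mu2.-integrable setT (EFin \o (fun p => a p.1 * b p.2)) /\
  \int[mu2]_p (a p.1 * b p.2) = (\int[mu]_x a x) * (\int[mu]_y b y).
Proof.
move=> ia ib; have /integrableP[/measurable_EFinP ma fa] := ia.
have /integrableP[/measurable_EFinP mb fb] := ib.
have mab : measurable_fun setT (EFin \o (fun p : point => a p.1 * b p.2)).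
  apply/measurable_EFinP; apply: measurable_funM.
  - exact: measurableT_comp ma measurable_fst.
  - exact: measurableT_comp mb measurable_snd.
have iab : mu2.-integrable setT (EFin \o (fun p => a p.1 * b p.2)).
  apply/(integrable12ltyP _ _ mab).
  under eq_integral => x _.
    under eq_integral => y _ do rewrite /= normrM EFinM.
    rewrite ge0_integralZl//; last by apply: measurableT_comp => //; apply: measurableT_comp.
    over.
  rewrite /= ge0_integralZr//.
  - by rewrite lte_mul_pinfty// ?integral_ge0// ge0_fin_numE// integral_ge0.
  - by apply: measurableT_comp => //; apply: measurableT_comp.
  - exact: integral_ge0.
split=> //; rewrite /Rintegral /torus2_measure -integral12_prod_meas1//.
rewrite -RintegralZr//; congr fine; apply: eq_integral => x _.
rewrite /fubini_F /=; under eq_integral do rewrite EFinM.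
rewrite integralZl// [in RHS]EFinM; congr (_ * _)%E.
by rewrite fineK//; exact: integrable_fin_num.
Qed.

Lemma bmfun_Lfun (g : 'rV[R]_d -> R) : bmfun g -> g \in Lfun mu +oo%E.
Proof.
move=> [mg [M gM]]; rewrite inE; apply/andP; split; rewrite inE//=.
rewrite /finite_norm unlock; case: ifPn => _; last exact: ltry.
apply: (@le_lt_trans _ _ M%:E); last exact: ltry.
by apply/ess_supP; apply: nearW => x /=; rewrite lee_fin.
Qed.

(** An essentially bounded function on a probability space is integrable, and
    remains so after multiplication by a bounded function. *)
Lemma Lfun_mul_integrable (f g : 'rV[R]_d -> R) : f \in Lfun mu +oo%E -> bmfun g ->
  mu.-integrable setT (EFin \o (fun x => g x * f x)).
Proof.
move=> fL [mg [M gM]].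
have /Lfun1_integrable fi : f \in Lfun mu 1%E.
  apply: (Lfun_subset (lexx _) (leey _) _ (leey _) fL).
  exact: fin_num_measure.
apply: (integrableMr (h := g) _ mg _ fi) => //.
exists M; split; first exact: num_real.
by move=> y My x _ /=; rewrite (le_trans (gM x))// ltW.
Qed.

(** The closure of this class under products is what makes it suitable for kernels
    that are themselves products over the coordinates. The weights may have any
    sign. *)
Definition separable (kap : 'rV[R]_d -> R) := exists (I : finType) (w : I -> R)
  (phi : I -> 'rV[R]_d -> R), (forall l, bmfun (phi l)) /\
  forall x u, kap (x - u) = \sum_l w l * (phi l x * phi l u).

Lemma separable_cst (a : R) : separable (fun=> a).
Proof.
exists unit, (fun=> a), (fun _ _ => 1); split; first by move=> _; exact: bmfun_cst.
by move=> x u; rewrite big_const card_unit /= !mulr1 addr0.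
Qed.

Lemma separableD k1 k2 : separable k1 -> separable k2 -> separable (fun x => k1 x + k2 x).
Proof.
move=> [I [w [phi [bphi E1]]]] [J [v [psi [bpsi E2]]]].
exists (I + J)%type, (fun l => match l with inl i => w i | inr j => v j end),
  (fun l => match l with inl i => phi i | inr j => psi j end).
split; first by case.
by move=> x u; rewrite big_sumType E1 E2.
Qed.

Lemma separableM k1 k2 : separable k1 -> separable k2 -> separable (fun x => k1 x * k2 x).
Proof.
move=> [I [w [phi [bphi E1]]]] [J [v [psi [bpsi E2]]]].
exists (I * J)%type, (fun l => w l.1 * v l.2), (fun l x => phi l.1 x * psi l.2 x).
split; first by move=> l; exact: bmfunM.
move=> x u; rewrite E1 E2 mulr_suml.
rewrite -(pair_bigA _ (fun i j => w i * v j * (phi i x * psi j x * (phi i u * psi j u)))) /=.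
apply: eq_bigr => i _; rewrite mulr_sumr; apply: eq_bigr => j _; ring.
Qed.

Lemma separable_sum (I : Type) (s : seq I) (k : I -> 'rV[R]_d -> R) :
  (forall i, separable (k i)) -> separable (fun x => \sum_(i <- s) k i x).
Proof.
move=> sk; elim: s => [|i s IH].
  by under eq_fun do rewrite big_nil; exact: separable_cst.
by under eq_fun do rewrite big_cons; exact: separableD.
Qed.

Lemma separable_prod (I : Type) (s : seq I) (k : I -> 'rV[R]_d -> R) :
  (forall i, separable (k i)) -> separable (fun x => \prod_(i <- s) k i x).
Proof.
move=> sk; elim: s => [|i s IH].
  by under eq_fun do rewrite big_nil; exact: separable_cst.
by under eq_fun do rewrite big_cons; exact: separableM.
Qed.

Lemma separable_cos (a : R) (j : 'I_d) :
  separable (fun x => cos (a * (pi *+ 2 * x ord0 j))).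
Proof.
exists bool, (fun=> 1), (fun l x => if l then cos (a * (pi *+ 2 * x ord0 j))
  else sin (a * (pi *+ 2 * x ord0 j))); split.
  have mj : measurable_fun setT (fun x : 'rV[R]_d => a * (pi *+ 2 * x ord0 j)).
    apply: measurable_funM; first exact: measurable_cst.
    by apply: measurable_funM; [exact: measurable_cst|exact: measurable_coord].
  case; split.
  - exact: measurableT_comp (continuous_measurable_fun (@continuous_cos R)) mj.
  - by exists 1 => x; exact: cos_max.
  - exact: measurableT_comp (continuous_measurable_fun (@continuous_sin R)) mj.
  - by exists 1 => x; exact: sin_max.
by move=> x u; rewrite big_bool /= !mul1r !mxE mulrBr mulrBr cosB.
Qed.

Lemma separable_dirichlet N (j : 'I_d) :
  separable (fun x => dirichlet_kernel N (x ord0 j)).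
Proof.
apply: separableD; first exact: separable_cst.
apply: separableM; first exact: separable_cst.
by apply: separable_sum => k; exact: separable_cos.
Qed.

Lemma separable_fejer N (j : 'I_d) : separable (fun x => fejer_kernel N (x ord0 j)).
Proof.
apply: separableM; first exact: separable_cst.
by apply: separable_sum => k; exact: separable_dirichlet.
Qed.

(** Both quadratic forms expand into the same double sum over [l] and [m]: the
    coefficients int phi_l f enter as the coordinates of the test function [g],
    which is bounded and hence admissible for [K]. *)
Lemma psd_separable K (kap : 'rV[R]_d -> R) (F : point -> R) :
  bmfun K -> separable kap ->
  (forall p, F p = \int[mu2]_q (K q * (kap (p - q).1 * kap (p - q).2))) ->
  psd K -> psd F.
Proof.
move=> bK [I [w [phi [bphi kapE]]]] FE psdK f fL.
have bphi2 l m : bmfun (fun q : point => phi l q.1 * phi m q.2).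
  by apply: bmfunM; [apply: bmfun_comp measurable_fst|apply: bmfun_comp measurable_snd].
pose k l m := \int[mu2]_q (K q * (phi l q.1 * phi m q.2)).
pose c l := \int[mu]_x (phi l x * f x).
have FE2 p : F p = \sum_(z : I * I) w z.1 * w z.2 * k z.1 z.2 * (phi z.1 p.1 * phi z.2 p.2).
  have bz (z : I * I) : bmfun (fun q => w z.1 * w z.2 * (phi z.1 p.1 * phi z.2 p.2) *
      (K q * (phi z.1 q.1 * phi z.2 q.2))).
    by apply: bmfunM; [exact: bmfun_cst|exact: bmfunM].
  rewrite FE; transitivity (\int[mu2]_q \sum_(z : I * I)
      (w z.1 * w z.2 * (phi z.1 p.1 * phi z.2 p.2) *
      (K q * (phi z.1 q.1 * phi z.2 q.2)))).
    apply: eq_Rintegral => q _; rewrite /= !kapE mulr_suml mulr_sumr.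
    rewrite -(pair_bigA _ (fun l m => w l * w m * (phi l p.1 * phi m p.2) *
      (K q * (phi l q.1 * phi m q.2)))) /=.
    apply: eq_bigr => l _; rewrite !mulr_sumr; apply: eq_bigr => m _; ring.
  rewrite mean_sum//; apply: eq_bigr => z _; rewrite meanZl; last exact: bmfunM.
  by rewrite /k mulrAC.
pose g x := \sum_l w l * c l * phi l x.
have bg : bmfun g by apply: bmfun_sum => l; apply: bmfunM => //; exact: bmfun_cst.
have := psdK g (bmfun_Lfun bg).
suff -> : \int[mu2]_p (K p * g p.1 * g p.2) = \int[mu2]_p (F p * f p.1 * f p.2) by [].
transitivity (\sum_(z : I * I) w z.1 * w z.2 * k z.1 z.2 * (c z.1 * c z.2)).
  have bz (z : I * I) : bmfun (fun q => w z.1 * c z.1 * (w z.2 * c z.2) *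
      (K q * (phi z.1 q.1 * phi z.2 q.2))).
    by apply: bmfunM; [exact: bmfun_cst|exact: bmfunM].
  transitivity (\int[mu2]_q \sum_(z : I * I) (w z.1 * c z.1 * (w z.2 * c z.2) *
      (K q * (phi z.1 q.1 * phi z.2 q.2)))).
    apply: eq_Rintegral => q _; rewrite /g -mulrA mulr_suml mulr_sumr.
    rewrite -(pair_bigA _ (fun l m => w l * c l * (w m * c m) *
      (K q * (phi l q.1 * phi m q.2)))) /=.
    apply: eq_bigr => l _; rewrite !mulr_sumr; apply: eq_bigr => m _; ring.
  rewrite mean_sum//; apply: eq_bigr => z _; rewrite meanZl; last exact: bmfunM.
  by rewrite /k; ring.
have fi l : mu.-integrable setT (EFin \o (fun x => phi l x * f x)).
  exact: Lfun_mul_integrable.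
have ti (z : I * I) := tensor_integral (fi z.1) (fi z.2).
pose cz (z : I * I) := w z.1 * w z.2 * k z.1 z.2.
have zi (z : I * I) : mu2.-integrable setT
    (EFin \o (fun p => cz z * ((phi z.1 p.1 * f p.1) * (phi z.2 p.2 * f p.2)))).
  exact: (integrableZl measurableT (cz z) (ti z).1).
have [_ sumE] := Rintegral_sum (index_enum (I * I)%type) zi.
transitivity (\int[mu2]_p \sum_(z : I * I)
    (cz z * ((phi z.1 p.1 * f p.1) * (phi z.2 p.2 * f p.2)))); last first.
  apply: eq_Rintegral => p _; rewrite FE2 !mulr_suml; apply: eq_bigr => z _.
  by rewrite /cz; ring.
rewrite sumE; apply: eq_bigr => z _.
rewrite RintegralZl//; last by case: (ti z).
by case: (ti z) => _ ->.
Qed.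

End positive_semidefinite.

(** * The theorem *)

Section fourier_as_convolution.
Variables (R : realType) (d : nat).
Notation point := ('rV[R]_d * 'rV[R]_d)%type.
Notation mu2 := (@torus2_measure R d).
Implicit Types (p q : point) (K : point -> R).

Lemma dirichlet_periodic N : periodic (@dirichlet_kernel R N) 1.
Proof.
move=> t; congr (1 + 2 * _); apply: eq_bigr => k _.
rewrite mulrDr mulr1 mulrDr [X in cos (_ + X)]mulr_natl.
exact: (periodicn (@cosD2pi R)).
Qed.

Lemma dirichlet_even N (t : R) : dirichlet_kernel N (- t) = dirichlet_kernel N t.
Proof. by congr (1 + 2 * _); apply: eq_bigr => k _; rewrite !mulrN cosN. Qed.

Lemma fejer_periodic N : periodic (@fejer_kernel R N) 1.
Proof. by move=> t; congr (_ * _); apply: eq_bigr => s _; exact: dirichlet_periodic. Qed.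

Lemma fejer_even N (t : R) : fejer_kernel N (- t) = fejer_kernel N t.
Proof. by congr (_ * _); apply: eq_bigr => s _; exact: dirichlet_even. Qed.

Lemma fourier_sum_conv K (r : {ffun 'I_d -> nat}) : torus_fun K -> continuous K ->
  fourier_sum K r r = torus_conv (axis_kernel (@dirichlet_kernel R) r) K.
Proof.
move=> pK cK; apply/funext => p.
rewrite fourier_sum_kernel; last exact: bmfun_torus_fun.
rewrite torus_conv_kernel//.
- by apply: eq_Rintegral => q _; rewrite prod_kernel_axis.
- by move=> c; exact: continuous_dirichlet.
- by move=> c; exact: dirichlet_periodic.
- by move=> c x; exact: dirichlet_even.
Qed.

Lemma fejer_conv K (r : {ffun 'I_d -> nat}) : torus_fun K -> continuous K ->
  fejer K r r = torus_conv (axis_kernel (@fejer_kernel R) r) K.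
Proof.
move=> pK cK; apply/funext => p.
rewrite fejer_kernel_integral; last exact: bmfun_torus_fun.
rewrite torus_conv_kernel//.
- by apply: eq_Rintegral => q _; rewrite prod_kernel_axis.
- by move=> c; exact: continuous_fejer.
- by move=> c; exact: fejer_periodic.
- by move=> c x; exact: fejer_even.
Qed.

Lemma sym_kernel_integral K (k : nat -> R -> R) (r : {ffun 'I_d -> nat}) (F : point -> R) :
  bmfun K -> (forall N, bmfun (k N : measurableTypeR R -> R)) ->
  (forall p, F p = \int[mu2]_q (K q * (tensor_kernel k r (p - q).1 * tensor_kernel k r (p - q).2))) ->
  sym_kernel K -> sym_kernel F.
Proof.
move=> bK bk FE symK x y; rewrite !FE torus2_swap; last first.
  by apply: bmfunM => //; exact: bmfun_tensor_kernel2.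
apply: eq_Rintegral => -[u v] _ /=.
by rewrite symK; congr (_ * _); rewrite mulrC.
Qed.

End fourier_as_convolution.

Theorem proposition4p4 (R : realType) (d : nat) (d_gt0 : (0 < d)%N)
    (K : 'rV[R]_d * 'rV[R]_d -> R) (K_torus : torus_fun K) (K_C2 : Ck 2 K) :
  [/\ psd K -> forall r : {ffun 'I_d -> nat},
        psd (fourier_sum K r r) /\ psd (fejer K r r),
      sym_kernel K -> forall r : {ffun 'I_d -> nat},
        sym_kernel (fourier_sum K r r) /\ sym_kernel (fejer K r r),
      (fun r => Ck_norm 2 (fejer K r r \- K)) @ min_infty d --> 0%E
    & Ck 3 K ->
      (fun r => Ck_norm 2 (fourier_sum K r r \- K)) @ min_infty d --> 0%E].
Proof.
have cK : continuous K by have [] := K_C2 [::] isT.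
have bK := bmfun_torus_fun K_torus cK.
have pK s := torus_fun_pderiv s K_torus.
split.
- move=> psdK r; split.
  + apply: (psd_separable (kap := tensor_kernel (@dirichlet_kernel R) r) bK) => //.
      by apply: separable_prod => j; exact: separable_dirichlet.
    by move=> p; exact: fourier_sum_kernel.
  + apply: (psd_separable (kap := tensor_kernel (@fejer_kernel R) r) bK) => //.
      by apply: separable_prod => j; exact: separable_fejer.
    by move=> p; exact: fejer_kernel_integral.
- move=> symK r; split.
  + apply: (sym_kernel_integral bK (@bmfun_dirichlet R)) => // p.
    exact: fourier_sum_kernel.
  + apply: (sym_kernel_integral bK (@bmfun_fejer R)) => // p.
    exact: fejer_kernel_integral.
- rewrite (_ : (fun r => _) =
      fun r => Ck_norm 2 (torus_conv (axis_kernel (@fejer_kernel R) r) K \- K)); last first.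
    by apply/funext => r; rewrite fejer_conv.
  apply: Ck_norm_cvg0 => //; first by move=> r c; exact: bmfun_fejer.
  move=> s s2 e e0; apply: fejer_conv_cvg => //.
  by have [] := K_C2 s s2.
- move=> K_C3; rewrite (_ : (fun r => _) =
      fun r => Ck_norm 2 (torus_conv (axis_kernel (@dirichlet_kernel R) r) K \- K)); last first.
    by apply/funext => r; rewrite fourier_sum_conv.
  apply: Ck_norm_cvg0 => //; first by move=> r c; exact: bmfun_dirichlet.
  move=> s s2 e e0; have [cs ds] := K_C3 s (leqW s2).
  apply: dirichlet_conv_cvg => //.
  + by move=> c q; exact: ds.
  + by move=> c; have [] := K_C3 (c :: s) s2.
Qed.
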